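(* Let $n\ge 2$ and $0\le j\le n$, and let $\mathcal{T}_n$ be the arrangement of hyperplanes $\{x_i+x_j=0\mid 1\le i<j\le n\}$ in $\mathbb{R}^n$. The absolute value of the coefficient of $t^j$ in the characteristic polynomial $\chi_{\mathcal{T}_n}(t)$ equals the number of labeled threshold graphs on vertex set $[n]$ with exactly $j$ odd anchors.
   Context: For a hyperplane arrangement $\mathcal{A}$ in $\mathbb{R}^n$, $\chi_{\mathcal{A}}(t)=\sum_{x\in L(\mathcal{A})}\mu(\hat 0,x)\,t^{\dim x}$, where $L(\mathcal{A})$ is the poset of nonempty intersections of hyperplanes ordered by reverse inclusion, $\hat 0=\mathbb{R}^n$, and $\mu$ its Möbius function. A signed permutation of $[n]$ is a permutation $\pi_1\cdots\pi_n$ of $[n]$ with a sign $w_i\in\{+,-\}$ assigned to each $\pi_i$. The construction associated to a signed permutation builds a graph on $[n]$ from the empty graph by adding $\pi_1,\dots,\pi_n$ in order, $\pi_i$ being added as a dominant vertex (adjacent to all previously added vertices) if $w_i=+$ and as a recessive vertex (adjacent to none of them) if $w_i=-$. Labeled threshold graphs on $[n]$ are the graphs so obtained; a construction of $G$ is a signed permutation whose construction yields $G$. A threshold pair in standard form is a signed permutation with $w_1=w_2$ and such that $w_i=w_{i+1}$ implies $\pi_i<\pi_{i+1}$; each labeled threshold graph $G$ has exactly one construction of this form, and the blocks of $G$ are the maximal runs of consecutive entries of equal sign in it, ordered left to right. A construction of $G$ follows the convention about vertex $1$ if, whenever $1$ lies in the first block of $G$, the construction adds $1$ first with sign $+$ (dominant).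 In a construction, an anchor is a vertex whose label is smaller than the labels of all vertices added after it (the first anchor is always $1$). An odd anchor is an anchor that is either the first anchor $1$ and dominant, or an anchor whose type (dominant/recessive) differs from that of the previous anchor. The number of odd anchors of $G$ is the number of odd anchors in any construction of $G$ following the convention about vertex $1$ (this number does not depend on the chosen construction). *)

(* Defs.v *)
From HB Require Import structures.
From mathcomp Require Import all_boot all_order all_algebra all_fingroup finmap.
From mathcomp Require Import reals.

Set Implicit Arguments.
Unset Strict Implicit.
Unset Printing Implicit Defensive.

Import Order.TTheory GRing.Theory Num.Theory.

Local Open Scope fset_scope.
Local Open Scope ring_scope.

Section Mobius.
Variables (T : choiceType) (le : rel T) (L : {fset T}).

(* The recursion descends strictly below y in L, so a depth of #|L| suffices:
   see mobius_xx and mobius_lt for the defining equations. *)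
Fixpoint mobius_rec (k : nat) (x y : T) : int :=
  if x == y then 1 else
  if k is k'.+1 then
    - \sum_(z <- L | [&& le x z, le z y & z != y]) mobius_rec k' x z
  else 0.

Definition mobius (x y : T) : int :=
  if le x y then mobius_rec #|` L| x y else 0.

Lemma mobius_xx (x : T) : reflexive le -> mobius x x = 1.
Proof. by move=> lexx; rewrite /mobius lexx; case: #|` L| => /=; rewrite eqxx. Qed.

Let below (x y : T) := [pred z | [&& le x z, le z y & z != y]].

Lemma mobius_rec_stable (x : T) : reflexive le -> antisymmetric le ->
  transitive le -> x \in L ->
  forall k k' y, le x y -> (count (below x y) L <= k)%N ->
    (count (below x y) L <= k')%N -> mobius_rec k x y = mobius_rec k' x y.
Proof.
move=> lexx leA leT xL.
have pos y : le x y -> x != y -> (0 < count (below x y) L)%N.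
  move=> xy nxy; rewrite -has_count; apply/hasP; exists x => //=.
  by rewrite lexx xy nxy.
elim=> [|k IH] [|k'] y xy /=; case: eqVneq => // nxy.
- by rewrite leqn0 => /eqP c0; move: (pos _ xy nxy); rewrite c0.
- by move=> _; rewrite leqn0 => /eqP c0; move: (pos _ xy nxy); rewrite c0.
move=> ck ck'; congr (- _); rewrite big_seq_cond [RHS]big_seq_cond.
apply: eq_bigr => z /and4P[zL xz zy nzy].
have lt : (count (below x z) L < count (below x y) L)%N.
  have -> : count (below x y) L
    = (count (predI (below x y) (pred1 z)) L
       + count (predI (below x y) (predC (pred1 z))) L)%N.
    rewrite -!size_filter -(count_predC (pred1 z) [seq t <- L | below x y t]).
    rewrite !count_filter !size_filter.
    by congr (_ + _)%N; apply: eq_count => t /=; rewrite andbC.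
  rewrite -add1n leq_add //.
    by rewrite -has_count; apply/hasP; exists z => //=; rewrite xz zy nzy eqxx.
  apply: sub_count => t /= /and3P[xt tz ntz].
  rewrite xt (leT _ _ _ tz zy) ntz andbT /=.
  apply/eqP => ty; subst t; move/eqP: nzy; apply.
  by apply: leA; rewrite zy tz.
by apply: IH => //; rewrite -ltnS; apply: leq_trans lt _.
Qed.

Lemma mobius_lt (x y : T) : reflexive le -> antisymmetric le -> transitive le ->
  x \in L -> y \in L -> le x y -> x != y ->
  mobius x y = - \sum_(z <- L | [&& le x z, le z y & z != y]) mobius x z.
Proof.
move=> lexx leA leT xL yL xy nxy.
have cL w : (count (below x w) L <= #|` L|)%N by exact: count_size.
rewrite {1}/mobius xy.
rewrite (@mobius_rec_stable x lexx leA leT xL _ #|` L|.+1 y xy) //; last first.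
  exact: leqW.
rewrite /= (negbTE nxy); congr (- _); apply: eq_bigr => z /and3P[xz _ _].
by rewrite /mobius xz.
Qed.

End Mobius.

Section CentralArrangement.
Variables (F : fieldType) (V : vectType F) (A : {fset {vspace V}}).

(* All members of A are linear, so every intersection contains 0 and the
   nonemptiness requirement on flats is automatic.  The empty subfamily
   contributes the whole space. *)
Definition flats : {fset {vspace V}} :=
  [fset (\bigcap_(H <- B) H)%VS | B : {fset {vspace V}} in fpowerset A].

Definition rev_incl : rel {vspace V} := fun X Y => (Y <= X)%VS.

Definition arr_char_poly : {poly int} :=
  \sum_(X <- flats) mobius rev_incl flats fullv X *: 'X^(\dim X).

End CentralArrangement.

Section ThresholdArrangement.
Variables (R : realType) (n : nat).

Definition coord_sum (i j : 'I_n) (x : 'rV[R]_n) : R^o := x ord0 i + x ord0 j.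

Fact coord_sum_is_linear (i j : 'I_n) : linear (coord_sum i j).
Proof.
by move=> a u v; rewrite /coord_sum !mxE scalerDr addrACA.
Qed.

HB.instance Definition _ (i j : 'I_n) :=
  GRing.isLinear.Build R 'rV[R]_n R^o _ (coord_sum i j)
    (coord_sum_is_linear i j).

Definition threshold_hyperplane (i j : 'I_n) : {vspace 'rV[R]_n} :=
  lker (linfun (coord_sum i j)).

Lemma mem_threshold_hyperplane (i j : 'I_n) (x : 'rV[R]_n) :
  (x \in threshold_hyperplane i j) = (x ord0 i + x ord0 j == 0).
Proof. by rewrite memv_ker lfunE. Qed.

Definition threshold_arrangement : {fset {vspace 'rV[R]_n}} :=
  [fset threshold_hyperplane p.1 p.2 | p : 'I_n * 'I_n & (p.1 < p.2)%N].

End ThresholdArrangement.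

Section ThresholdGraphs.
Variable n : nat.

(* Labels and positions are counted from 0: the vertex 1 of [n] is the element
   of 'I_n with value 0. *)

(* A graph on [n] is given by its set of edges. *)
Definition graph := {set {set 'I_n}}.

(* (pi, w): pi i is the vertex added at step i, and w i = true means that it is
   added with sign +. *)
Definition signed_perm := ('S_n * {ffun 'I_n -> bool})%type.

Definition graph_of (c : signed_perm) : graph :=
  [set [set c.1 ik.1; c.1 ik.2] |
    ik : 'I_n * 'I_n & (ik.1 < ik.2)%N && c.2 ik.2].

Definition is_threshold (G : graph) : bool := [exists c, graph_of c == G].

Definition standard_form (c : signed_perm) : bool :=
  [forall i : 'I_n, forall k : 'I_n,
     ((i == 0%N :> nat) && (k == 1%N :> nat)) ==> (c.2 i == c.2 k)]
  && [forall i : 'I_n, forall k : 'I_n,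
     ((k == i.+1 :> nat) && (c.2 i == c.2 k)) ==> (c.1 i < c.1 k)%N].

Definition in_first_block (G : graph) (v : 'I_n) : bool :=
  [exists c, [&& standard_form c, graph_of c == G
    & [exists i, (c.1 i == v)
         && [forall k : 'I_n, (k <= i)%N ==> (c.2 k == c.2 i)]]]].

Definition follows_convention (c : signed_perm) : bool :=
  [forall v : 'I_n, ((v == 0%N :> nat) && in_first_block (graph_of c) v) ==>
     [exists i : 'I_n, [&& i == 0%N :> nat, c.1 i == v & c.2 i]]].

(* Anchors are identified with the steps at which they are added. *)
Definition anchor (c : signed_perm) (i : 'I_n) : bool :=
  [forall k : 'I_n, (i < k)%N ==> (c.1 i < c.1 k)%N].

Definition previous_anchor (c : signed_perm) (p i : 'I_n) : bool :=
  [&& anchor c p, (p < i)%N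
    & [forall k : 'I_n, (p < k < i)%N ==> ~~ anchor c k]].

Definition odd_anchor (c : signed_perm) (i : 'I_n) : bool :=
  anchor c i
  && (((c.1 i == 0%N :> nat) && c.2 i)
      || [exists p, previous_anchor c p i && (c.2 p != c.2 i)]).

(* The count does not depend on the construction picked; one exists for every
   threshold graph, so the default 0 only affects other graphs. *)
Definition odd_anchors (G : graph) : nat :=
  if [pick c | (graph_of c == G) && follows_convention c] is Some c
  then #|[set i | odd_anchor c i]| else 0%N.

End ThresholdGraphs.

(* Main.v *)
Require Import Defs.
From mathcomp Require Import all_boot all_order all_algebra all_fingroup finmap.
From mathcomp Require Import reals.
From mathcomp Require Import zify ring.

Set Implicit Arguments.
Unset Strict Implicit.
Unset Printing Implicit Defensive.

Import Order.TTheory GRing.Theory Num.Theory.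

(** Every flat [X] of the arrangement is cut out by equations [x_i = 0] and
    [x_i = +- x_j], so it contains exactly [(2m+1)^(dim X)] points of the box
    [{-m..m}^n].  By Moebius inversion [chi(2m+1)] is the number of box points
    on no hyperplane, whose exponential generating function in [n] is
    [(1 + x) (2 e^x - 1)^m].

    A threshold graph has a unique standard construction, a word of signed
    labels in which labels increase along equal signs and the first two signs
    agree.  Dropping the last condition gives canonical words; counting them by
    number [j] of sign changes along anchors, with weight [t^j], yields
    polynomials [y_n(t)], and the graphs contribute [y_n - n y_(n-1)].
    Splitting off the first letter gives a recurrence which shows that
    [(-1)^n y_n(-(2m+1))] is the coefficient of [x^n/n!] in [(2 e^x - 1)^m].
    Hence [chi(t)] and [(-1)^n (y_n - n y_(n-1))(-t)] agree at all odd [t]. *)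

(** * Reciprocity between words and colorings *)

Section Pascal.
Local Open Scope ring_scope.
Variable R : pzRingType.
Implicit Types (z w : nat -> R) (n r : nat).

(* For [r <= n] this is [\sum_i 'C(r, i) * z (n - i)]. *)
Fixpoint pascal z n r : R :=
  if r is r'.+1 then pascal z n r' + pascal z n.-1 r' else z n.

Lemma pascalD z w n r :
  pascal (fun i => z i + w i) n r = pascal z n r + pascal w n r.
Proof. by elim: r n => [|r IH] n //=; rewrite !IH addrACA. Qed.

Lemma pascalZ a z n r : pascal (fun i => a * z i) n r = a * pascal z n r.
Proof. by elim: r n => [|r IH] n //=; rewrite !IH mulrDr. Qed.

Lemma pascalS z n r : (r <= n)%N ->
  pascal z n.+1 r = pascal (fun i => z i.+1) n r.
Proof.
elim: r n => [|r IH] n //= rn; rewrite IH; last by lia.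
by case: n rn => // n rn; rewrite IH.
Qed.

Lemma pascalB_eq_below z w n r : (r <= n)%N ->
  (forall i, (i < n)%N -> z i = w i) ->
  pascal z n r - pascal w n r = z n - w n.
Proof.
elim: r n => [|r IH] n //= rn eqzw.
have -> : pascal z n.-1 r = pascal w n.-1 r.
  apply/eqP; rewrite -subr_eq0 IH; [|by lia|by move=> i i_lt; apply: eqzw; lia].
  by rewrite eqzw ?subrr //; lia.
by rewrite opprD addrACA subrr addr0 IH //; lia.
Qed.

End Pascal.

Section Colorings.

(* Number of ways to color an [n]-set with [k] unrestricted colors, [l] pairs of
   opposite colors that exclude each other, and [f] colors to be used at most
   once; its exponential generating function is
   [e^(k x) (2 e^x - 1)^l (1 + x)^f]. *)
Fixpoint colorings n k l f : nat :=
  if n is n'.+1 then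
    k * colorings n' k l f + 2 * l * colorings n' k.+1 l.-1 f
    + f * colorings n' k l f.-1
  else 1.

Lemma coloringsS n k l f : colorings n.+1 k l f =
  k * colorings n k l f + 2 * l * colorings n k.+1 l.-1 f
  + f * colorings n k l f.-1.
Proof. by []. Qed.

Lemma colorings_singleS n k l f :
  colorings n k l f.+1 = colorings n k l f + n * colorings n.-1 k l f.
Proof.
elim: n k l f => [|[|n] IH] k l f //; first by rewrite /=; ring.
rewrite !(coloringsS n.+1) [_.+1.-1]/=.
case: f => [|f]; rewrite !IH /=; first by lia.
by have /(congr1 (muln n.+1)) := IH k l f; rewrite /=; lia.
Qed.

Lemma colorings_pairS n k l f :
  colorings n k l.+1 f + colorings n k l f = 2 * colorings n k.+1 l f.
Proof.
elim: n k l f => [|n IH] k l f //=.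
have := IH k l f; have := IH k l f.-1; case: l => [|l] /=; first by nia.
by have := IH k.+1 l f; nia.
Qed.

Local Open Scope ring_scope.

Lemma pascal_colorings n k l f :
  pascal (fun i => (colorings i k l f)%:Z) n n = (colorings n k.+1 l f)%:Z.
Proof.
elim: n k l f => [|n IH] k l f //=.
rewrite pascalS // IH.
rewrite -[pascal _ n n]/(pascal (fun i => k%:Z * (colorings i k l f)%:Z
  + (2 * l)%:Z * (colorings i k.+1 l.-1 f)%:Z
  + f%:Z * (colorings i k l f.-1)%:Z) n n).
by rewrite !pascalD !pascalZ !IH /=; lia.
Qed.

Lemma coloringsS_pascal n m :
  (colorings n.+1 0 m 0)%:Z =
  2 * pascal (fun i => (colorings i.+1 0 m 0)%:Z) n n
  - (2 * m)%:Z * pascal (fun i => (colorings i 0 m 0)%:Z) n n.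
Proof.
have := pascal_colorings n.+1 0 m 0; rewrite [pascal _ _ _]/=.
rewrite !pascal_colorings pascalS //= => /(canRL (addrK _)) ->.
case: m => [|m] /=; first by lia.
by have := colorings_pairS n 1 m 0; nia.
Qed.

End Colorings.

Section WordSums.
Local Open Scope ring_scope.
Variables (R : comNzRingType) (t : R).
Implicit Types (n r k : nat) (b : bool).

(* Contribution of the words whose first label is the [k]-th smallest, given the
   sums [w] over the remaining words: the first letter is an anchor iff [k = 0],
   and [b] tells whether it has the sign of the last anchor. *)
Definition head_weight (w : nat -> bool -> R) k b : R :=
  if k == 0%N then (if b then 1 else t) * w 0%N true else w k b.

(* Weighted number of canonical words on [n] labels after a letter that [r] of
   them precede; [b] tells whether this letter has the sign of the last anchor.
   The two summands are for a next letter of opposite and of equal sign. *)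
Fixpoint word_sum n r b : R :=
  if n is n'.+1 then
    \sum_(0 <= k < n) (head_weight (word_sum n') k (~~ b)
                       + (r <= k)%N%:R * head_weight (word_sum n') k b)
  else 1.

#[global] Arguments word_sum : simpl never.

Lemma word_sumS n r b : word_sum n.+1 r b =
  \sum_(0 <= k < n.+1) (head_weight (word_sum n) k (~~ b)
                         + (r <= k)%N%:R * head_weight (word_sum n) k b).
Proof. by []. Qed.

Lemma word_sum_rank0 n b : word_sum n 0 b = word_sum n 0 true.
Proof.
case: n => [//|n]; rewrite !word_sumS; apply: eq_bigr => k _ /=.
by case: b; rewrite !mul1r //= addrC.
Qed.

Lemma word_sum_rank_max n b : word_sum n.+1 n.+1 b =
  \sum_(0 <= k < n.+1) head_weight (word_sum n) k (~~ b).
Proof.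
rewrite word_sumS; apply: eq_big_nat => k /andP[_ k_lt].
by rewrite ltnNge -ltnS k_lt mul0r addr0.
Qed.

Lemma word_sum_rank_maxD n :
  word_sum n.+1 n.+1 true + word_sum n.+1 n.+1 false = word_sum n.+1 0 true.
Proof.
rewrite !word_sum_rank_max word_sumS big_split /=; congr (_ + _).
by apply: eq_bigr => k _; rewrite mul1r.
Qed.

Lemma word_sum_rankS n r b : (r <= n)%N ->
  word_sum n.+1 r.+1 b = word_sum n.+1 r b - head_weight (word_sum n) r b.
Proof.
move=> rn; apply/eqP; rewrite eq_sym subr_eq !word_sumS !big_split /= -addrA.
apply/eqP; congr (_ + _).
rewrite (bigD1_seq r) ?mem_index_iota ?iota_uniq //= leqnn mul1r addrC.
rewrite [in RHS](bigD1_seq r) ?mem_index_iota ?iota_uniq //= ltnn mul0r add0r.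
by congr (_ + _); apply: eq_bigr => k /negPf kr; rewrite ltn_neqAle eq_sym kr.
Qed.

Lemma word_sum_pascal n r b : (r <= n)%N ->
  (-1) ^+ n.+1 * word_sum n.+1 r.+1 b =
  pascal (fun i => (-1) ^+ i.+1 * word_sum i.+1 0 true
     + (if b then 1 else t) * ((-1) ^+ i * word_sum i 0 true)) n r.
Proof.
elim: r n => [|r IH] n rn.
  rewrite word_sum_rankS //= (word_sum_rank0 n.+1 b) /head_weight eqxx.
  by rewrite exprS mulN1r !mulNr mulrBr opprB addrC mulrCA.
case: n rn => // n rn.
rewrite word_sum_rankS // mulrBr IH /=; last by lia.
by congr (_ + _); rewrite -IH // /head_weight [in LHS]exprS mulN1r mulNr opprK.
Qed.

Lemma word_sumS_pascal n :
  (-1) ^+ n.+1 * word_sum n.+1 0 true =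
  2 * pascal (fun i => (-1) ^+ i.+1 * word_sum i.+1 0 true) n n
  + (1 + t) * pascal (fun i => (-1) ^+ i * word_sum i 0 true) n n.
Proof.
rewrite -word_sum_rank_maxD mulrDr !word_sum_pascal // !pascalD !pascalZ.
ring.
Qed.

End WordSums.

Section Reciprocity.
Local Open Scope ring_scope.

(* Both sides satisfy the same linear recurrence, [1 + t] being [- 2 m]. *)
Lemma word_sum_reciprocity m n :
  (-1) ^+ n * word_sum (- (2 * m).+1%:Z) n 0 true = (colorings n 0 m 0)%:Z.
Proof.
elim/ltn_ind: n => -[|n] IH //.
set t := - (2 * m).+1%:Z in IH *.
set words := fun i => (-1) ^+ i * word_sum t i 0 true.
set cols := fun i => (colorings i 0 m 0)%:Z.
have eq_tail :
    pascal (fun i => words i.+1) n n - pascal (fun i => cols i.+1) n n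
    = words n.+1 - cols n.+1.
  by apply: pascalB_eq_below => // i i_lt; exact: (IH i.+1).
have eq_low : pascal words n n = pascal cols n n.
  apply/eqP; rewrite -subr_eq0 (pascalB_eq_below (leqnn n)) /words.
    by rewrite IH // subrr.
  by move=> i i_lt; exact: IH (leqW i_lt).
have words_rec : words n.+1 = 2 * pascal (fun i => words i.+1) n n
    - (2 * m)%:Z * pascal words n n.
  by rewrite [LHS]word_sumS_pascal -mulNr; congr (_ + _ * _); rewrite /t; lia.
have cols_rec : cols n.+1 = 2 * pascal (fun i => cols i.+1) n n
    - (2 * m)%:Z * pascal cols n n := coloringsS_pascal n m.
rewrite -[LHS]/(words n.+1) -[RHS]/(cols n.+1).
by move: words_rec cols_rec eq_tail; rewrite eq_low; lia.
Qed.

End Reciprocity.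

(** * The characteristic polynomial *)

Section PointCounting.
Local Open Scope fset_scope.
Local Open Scope ring_scope.
Variables (F : fieldType) (V : vectType F) (A : {fset {vspace V}}).
Implicit Types (X Y H : {vspace V}) (v : V).

Lemma memv_bigcap_seq (s : seq {vspace V}) v :
  (v \in (\bigcap_(H <- s) H)%VS) = all (fun H => v \in H) s.
Proof.
elim: s => [|H s IH]; first by rewrite big_nil memvf.
by rewrite big_cons memv_cap IH.
Qed.

Lemma flatsP X :
  reflect
    (exists2 B : {fset {vspace V}}, B `<=` A & X = (\bigcap_(H <- B) H)%VS)
    (X \in flats A).
Proof.
apply: (iffP (imfsetP _ _ _ _)) => -[B /= BA ->]; exists B => //.
  by move: BA; rewrite fpowersetE.
by rewrite fpowersetE.
Qed.

Lemma flats_full : fullv \in flats A.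
Proof. by apply/flatsP; exists fset0; rewrite ?fsub0set // big_seq_fset0. Qed.

Lemma sum_mobius_flats Y : Y \in flats A ->
  \sum_(X <- flats A | (Y <= X)%VS) mobius (@rev_incl F V) (flats A) fullv X
  = (Y == fullv)%:R.
Proof.
move=> YL.
have incl_refl : reflexive (@rev_incl F V) by move=> X; exact: subvv.
have incl_trans : transitive (@rev_incl F V).
  by move=> X Z T XZ ZT; apply: subv_trans ZT XZ.
have incl_anti : antisymmetric (@rev_incl F V).
  by move=> X Z /andP[XZ ZX]; apply: subv_anti; apply/andP.
rewrite big_mkcond (bigD1_seq Y) ?fset_uniq //= subvv -big_mkcondr.
have [->|nY] := eqVneq Y fullv.
  rewrite mobius_xx // big1 ?addr0 // => X /andP[nX fX].
  by case/eqP: nX; apply: subv_anti; rewrite subvf fX.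
rewrite mobius_lt ?flats_full 1?eq_sym //; last exact: subvf.
apply/eqP; rewrite addrC subr_eq0; apply/eqP; apply: eq_bigl => X.
by rewrite /rev_incl subvf andbC.
Qed.

Definition flat_at v : {vspace V} :=
  (\bigcap_(H <- [fset H in A | v \in H]) H)%VS.

Lemma flat_at_flat v : flat_at v \in flats A.
Proof.
by apply/flatsP; exists [fset H in A | v \in H] => //; exact: fset_sub.
Qed.

Lemma memv_flat_at v : v \in flat_at v.
Proof.
by rewrite memv_bigcap_seq; apply/allP => H; rewrite !inE => /andP[].
Qed.

Lemma memv_flatE v X : X \in flats A -> (v \in X) = (flat_at v <= X)%VS.
Proof.
move=> /flatsP[B /fsubsetP BA ->].
apply/idP/idP => [|/subvP]; last by apply; exact: memv_flat_at.
rewrite memv_bigcap_seq => /allP vB; apply/subvP => u.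
rewrite !memv_bigcap_seq => /allP uA; apply/allP => H HB.
by apply: uA; rewrite !inE BA //= vB.
Qed.

Lemma flat_at_full v : fullv \notin A ->
  (flat_at v == fullv) = all (fun H => v \notin H) A.
Proof.
move=> nA; apply/eqP/allP => [fv H HA|vA].
  apply: contraNN nA => vH; rewrite -(_ : H = fullv) //.
  apply: subv_anti; rewrite subvf -fv; apply/subvP => u.
  by rewrite memv_bigcap_seq => /allP; apply; rewrite !inE HA.
rewrite /flat_at big1_seq // => H; rewrite !inE => /= /andP[HA].
by rewrite (negbTE (vA H HA)).
Qed.

(* The finite field method with an arbitrary finite set of test points. *)
Lemma arr_char_poly_count (P : finType) (e : P -> V) (q : nat) :
  fullv \notin A ->
  (forall X, X \in flats A -> #|[set p | e p \in X]| = q ^ \dim X)%N ->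
  (arr_char_poly A).[q%:Z] =
  #|[set p | all (fun H => e p \notin H) A]|%:Z.
Proof.
move=> nA cardX; rewrite /arr_char_poly horner_sum.
set mu := mobius _ _ _.
transitivity (\sum_(X <- flats A) \sum_(p : P) if e p \in X then mu X else 0).
  apply: eq_big_seq => X XL; rewrite hornerZ hornerXn -big_mkcond /= sumr_const.
  by rewrite -[X in _ *+ X]cardsE cardX // -[RHS]mulr_natr natrX natz.
rewrite exchange_big /= -sum1_card (big_morph Posz PoszD erefl) [RHS]big_mkcond.
apply: eq_bigr => p _; rewrite inE -big_mkcond /= -flat_at_full //.
have above X : (X \in flats A) && (e p \in X)
    = (X \in flats A) && (flat_at (e p) <= X)%VS.
  by apply: andb_id2l => /memv_flatE.
rewrite big_seq_cond (eq_bigl _ _ above) -big_seq_cond.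
by rewrite sum_mobius_flats ?flat_at_flat //; case: eqP.
Qed.

End PointCounting.

Lemma card_set_tupleS (T : finType) n (P : pred (seq T)) :
  #|[set s : n.+1.-tuple T | P s]|
  = \sum_a #|[set s : n.-tuple T | P (a :: s)]|.
Proof.
pose cons_tuple (p : T * n.-tuple T) := [tuple of p.1 :: p.2].
pose uncons (s : n.+1.-tuple T) := (thead s, [tuple of behead s]).
rewrite -sum1dep_card (reindex cons_tuple) /=; last first.
  exists uncons => [[a s] _|s _]; last by rewrite /cons_tuple /= -tuple_eta.
  by rewrite /uncons theadE; congr pair; apply: val_inj.
rewrite -(pair_big_dep xpredT (fun a (s : n.-tuple T) => P (a :: s))
  (fun _ _ => 1)).
by apply: eq_bigr => a _; rewrite sum1dep_card.
Qed.

Section OppositeFree.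
Variables (L : finType) (opp : L -> L).
Hypothesis oppK : involutive opp.
Implicit Types (U : {set L}) (a : L) (s : seq L).

Definition opp_free s : bool := pairwise (fun a b => opp b != a) s.

Definition opp_free_after U s : bool :=
  all (fun a => opp a \notin U) s && opp_free s.

Lemma opp_free_after_cons U a s :
  opp_free_after U (a :: s) = (opp a \notin U) && opp_free_after (a |: U) s.
Proof.
rewrite /opp_free_after /opp_free /= -!andbA; congr (_ && _).
rewrite andbA -all_predI; congr (_ && _); apply: eq_all => b /=.
by rewrite !inE negb_or andbC.
Qed.

(* After the entries in [U], these are the ones that may be used again, the ones
   competing with a distinct opposite, and those that may be used just once. *)
Definition repeatable U := [set a in U | opp a != a].
Definition undecided U :=
  [set a | [&& opp a != a, a \notin U & opp a \notin U]].
Definition unused_fixed U := [set a | (opp a == a) && (a \notin U)].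

Definition consistent U := {in U, forall a, opp a \in U -> opp a = a}.

Lemma sum_opp_notin U (g : L -> nat) : consistent U ->
  \sum_(a | opp a \notin U) g a =
  \sum_(a in repeatable U) g a + \sum_(a in undecided U) g a
  + \sum_(a in unused_fixed U) g a.
Proof.
move=> cU; rewrite (bigID (mem U)).
rewrite (bigID (fun a => opp a == a) (fun a => _ && ~~ _)) /=.
rewrite addnA addnAC; congr (_ + _ + _); apply: eq_bigl => a; rewrite !inE.
- rewrite andbC; apply: andb_id2l => aU; apply/idP/idP.
    by apply: contraNneq => ->.
  by apply: contraNN => /(cU a aU) ->.
- by rewrite andbC [(opp a \notin U) && _]andbC.
- by rewrite andbC; case: eqP => //= ->; rewrite andbb.
Qed.

Lemma consistentU1 U a : consistent U -> opp a \notin U -> consistent (a |: U).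
Proof.
move=> cU oaU b; rewrite !inE => /predU1P[->|bU] /predU1P[ob|obU] //.
- by rewrite obU in oaU.
- by move: oaU; rewrite -ob oppK bU.
- exact: cU.
Qed.

Lemma card_repeatableU1 U a : a \in undecided U ->
  #|repeatable (a |: U)| = #|repeatable U|.+1.
Proof.
rewrite inE => /and3P[oa aU oaU].
have -> : repeatable (a |: U) = a |: repeatable U.
  by apply/setP => b; rewrite !inE; case: eqP => [->|].
by rewrite cardsU1 inE (negbTE aU).
Qed.

Lemma card_undecidedU1 U a : a \in undecided U ->
  #|undecided U| = #|undecided (a |: U)|.+2.
Proof.
move=> aD; have oaD : opp a \in undecided U :\ a.
  by move: aD; rewrite !inE oppK => /and3P[oa -> ->]; rewrite [a == _]eq_sym oa.
rewrite (cardsD1 a) aD (cardsD1 (opp a)) oaD !add1n; congr _.+2.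
apply: eq_card => b; rewrite !inE !negb_or (can2_eq oppK oppK b a).
by do 3!case: (_ == _) => //=; rewrite ?andbF.
Qed.

Lemma unused_fixedU1 U a : opp a != a -> unused_fixed (a |: U) = unused_fixed U.
Proof.
move=> oa; apply/setP => b; rewrite !inE negb_or; case: (b =P a) => //= ->.
by rewrite (negbTE oa).
Qed.

Lemma repeatableU1_fixed U a : opp a = a -> repeatable (a |: U) = repeatable U.
Proof.
move=> oa; apply/setP => b; rewrite !inE.
by case: (b =P a) => // ->; rewrite oa eqxx !andbF.
Qed.

Lemma undecidedU1_fixed U a : opp a = a -> undecided (a |: U) = undecided U.
Proof.
move=> oa; apply/setP => b; rewrite !inE !negb_or (can2_eq oppK oppK b a) oa.
by case: (b =P a) => // ->; rewrite oa eqxx.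
Qed.

Lemma card_unused_fixedU1 U a : a \in unused_fixed U ->
  #|unused_fixed U| = #|unused_fixed (a |: U)|.+1.
Proof.
move=> aF; rewrite (cardsD1 a) aF add1n; congr _.+1.
by apply: eq_card => b; rewrite !inE negb_or andbCA.
Qed.

Lemma card_opp_free_after n U l f : consistent U ->
  #|undecided U| = 2 * l -> #|unused_fixed U| = f ->
  #|[set s : n.-tuple L | opp_free_after U s]|
  = colorings n #|repeatable U| l f.
Proof.
elim: n U l f => [|n IH] U l f cU card_und card_fix.
  rewrite (eq_card (B := predT)) ?card_tuple ?expn0 // => s.
  by rewrite inE tuple0.
rewrite card_set_tupleS (bigID (fun a => opp a \in U)) /=.
rewrite big1 ?add0n; last first.
  by move=> a oaU; apply: eq_card0 => s; rewrite inE opp_free_after_cons oaU.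
pose count_after (a : L) := #|[set s : n.-tuple L | opp_free_after (a |: U) s]|.
rewrite (eq_bigr count_after) => [|a oaU]; last first.
  by apply: eq_card => s; rewrite !inE opp_free_after_cons oaU.
rewrite sum_opp_notin //.
have -> : \sum_(a in repeatable U) count_after a
    = #|repeatable U| * colorings n #|repeatable U| l f.
  rewrite -sum_nat_const; apply: eq_bigr => a; rewrite inE => /andP[aU _].
  by rewrite /count_after (setUidPr _) ?sub1set // (IH U l f).
have -> : \sum_(a in undecided U) count_after a
    = 2 * l * colorings n #|repeatable U|.+1 l.-1 f.
  rewrite -card_und -sum_nat_const; apply: eq_bigr => a aD.
  move: (aD); rewrite inE => /and3P[oa _ oaU].
  have := card_undecidedU1 aD; rewrite card_und => card_und_S.
  rewrite /count_after -(card_repeatableU1 aD) (IH _ l.-1 f) ?unused_fixedU1 //.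
    exact: consistentU1.
  by lia.
congr (_ + _); rewrite -card_fix -sum_nat_const; apply: eq_bigr => a aF.
move: (aF); rewrite inE => /andP[/eqP oa aU].
rewrite /count_after (IH _ l #|unused_fixed U|.-1) ?undecidedU1_fixed //.
- by rewrite repeatableU1_fixed.
- by apply: consistentU1; rewrite ?oa.
- by rewrite (card_unused_fixedU1 aF).
Qed.

Lemma card_opp_free n l f : #|[set a | opp a != a]| = 2 * l ->
  #|[set a | opp a == a]| = f ->
  #|[set s : n.-tuple L | opp_free s]| = colorings n 0 l f.
Proof.
move=> card_und card_fix; have -> : 0 = #|repeatable set0|.
  by apply/esym/eqP; rewrite cards_eq0; apply/eqP/setP => a; rewrite !inE.
rewrite -card_opp_free_after.
- apply: eq_card => s; rewrite !inE /opp_free_after.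
  by rewrite (eq_all (a2 := predT)) ?all_predT // => a; rewrite !inE.
- by move=> a; rewrite inE.
- by rewrite -card_und; apply: eq_card => a; rewrite !inE !andbT.
- by rewrite -card_fix; apply: eq_card => a; rewrite !inE andbT.
Qed.

End OppositeFree.

Section SignParametrization.
Local Open Scope ring_scope.

Definition is_sign (c : int) := [|| c == 0, c == 1 | c == -1].

Lemma is_signM c d : is_sign c -> is_sign d -> is_sign (c * d).
Proof. by move=> /or3P[]/eqP-> /or3P[]/eqP->. Qed.

Lemma is_signN c : is_sign c -> is_sign (- c).
Proof. by move=> /or3P[]/eqP->. Qed.

Lemma dim_cap_lker (K : fieldType) (V : vectType K) (X : {vspace V})
    (f : 'Hom(V, K^o)) x :
  x \in X -> f x != 0 -> \dim X = (\dim (X :&: lker f)).+1.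
Proof.
move=> xX fx; rewrite -(limg_ker_dim f X) -[RHS]addn1; congr (_ + _)%N.
apply/eqP; rewrite eqn_leq; apply/andP; split.
  by have := dimvS (subvf (f @: X)%VS); rewrite dimvf /dim /=.
rewrite lt0n dimv_eq0; apply: contraNneq fx => f0.
by rewrite -memv0 -f0 memv_img.
Qed.

Section Field.
Variables (K : fieldType) (n : nat).
Implicit Types (X : {vspace 'rV[K]_n}) (B : {set 'I_n}).

(* [X] is cut out by the equations [x i = s i * x (r i)], the coordinates in
   [B] being free. *)
Record parametrized X B (r : 'I_n -> 'I_n) (s : 'I_n -> int) : Prop := {
  param_free : forall i, i \in B -> r i = i /\ s i = 1;
  param_sign : forall i, is_sign (s i);
  param_rep : forall i, s i != 0 -> r i \in B;
  param_mem : forall x,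
    (x \in X) = [forall i, x ord0 i == (s i)%:~R * x ord0 (r i)];
  param_dim : \dim X = #|B| }.

Definition sign_parametrizable X := exists B r s, parametrized X B r s.

Lemma sign_parametrizable_full : sign_parametrizable fullv.
Proof.
exists setT, id, (fun=> 1); split => // [i|x|]; first by rewrite inE.
  by rewrite memvf; apply/esym/forallP => i; rewrite mul1r.
by rewrite dimvf /dim /= mul1n cardsT card_ord.
Qed.

Lemma parametrized_cap_lker X B r s (f : 'Hom('rV[K]_n, K^o)) a b (c : int) :
  parametrized X B r s -> b \in B -> is_sign c ->
  (c != 0 -> (a \in B) && (a != b)) ->
  (forall x, x \in X -> (f x == 0) = (x ord0 b == c%:~R * x ord0 a)) ->
  parametrized (X :&: lker f)%VS (B :\ b) (fun i => if r i == b then a else r i)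
    (fun i => if r i == b then s i * c else s i).
Proof.
move=> [free_s sign_s rep_r memX dimX] bB cs ca fE; have [rb sb] := free_s b bB.
split.
- by move=> i; rewrite !inE => /andP[ib /free_s[ri si]]; rewrite ri (negbTE ib).
- by move=> i; case: ifP => // _; exact: is_signM.
- move=> i; case: ifP => [_|rib si]; last by rewrite !inE rib rep_r.
  by rewrite mulf_eq0 negb_or => /andP[_ /ca /andP[aB ab]]; rewrite !inE ab.
- move=> x; rewrite memv_cap memv_ker; apply/andP/forallP => [[xX]|xE].
    rewrite fE // => /eqP xb i.
    move: (xX); rewrite memX => /forallP /(_ i) /eqP xi.
    by case: (r i =P b) xi => [->|_] -> //; rewrite xb intrM mulrA.
  have xb : x ord0 b = c%:~R * x ord0 a.
    by have /eqP := xE b; rewrite rb eqxx sb mul1r.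
  have xX : x \in X.
    rewrite memX; apply/forallP => i; have /eqP xi := xE i.
    by case: (r i =P b) xi => [->|_] -> //; rewrite xb intrM mulrA.
  by rewrite fE // xb.
- pose x : 'rV[K]_n := \row_i ((s i)%:~R * (r i == b)%:R).
  have xX : x \in X.
    rewrite memX; apply/forallP => i; rewrite !mxE.
    have [->|/rep_r/free_s[-> ->]] := eqVneq (s i) 0; first by rewrite !mul0r.
    by rewrite mul1r.
  have fx : f x != 0.
    rewrite fE // !mxE rb sb eqxx mul1r.
    have [->|/ca /andP[aB ab]] := eqVneq c 0; first by rewrite mul0r oner_eq0.
    by have [-> _] := free_s a aB; rewrite (negbTE ab) !mulr0 oner_eq0.
  by have := dim_cap_lker xX fx; rewrite dimX (cardsD1 b) bB add1n => -[].
Qed.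

End Field.

Section NumField.
Variables (K : numFieldType) (n : nat).
Implicit Types (X : {vspace 'rV[K]_n}) (B : {set 'I_n}).

(* If [d] is a unit, [f x = 0] reads [x b = - (c d) x a] when [a != b], and
   [x b = 0] or nothing at all when [a = b]. *)
Lemma sign_parametrizable_cap_lker X B r s (f : 'Hom('rV[K]_n, K^o)) a b
    (c d : int) :
  parametrized X B r s -> is_sign c -> is_sign d ->
  (c != 0 -> a \in B) -> (d != 0 -> b \in B) ->
  (forall x, x \in X -> f x = c%:~R * x ord0 a + d%:~R * x ord0 b) ->
  sign_parametrizable (X :&: lker f).
Proof.
move=> pX; wlog d0 : a b c d / d != 0 => [hwlog|] cs ds ca db fE.
  have [d_eq0|d_neq0] := eqVneq d 0; last exact: (hwlog a b c d).
  have [c_eq0|c_neq0] := eqVneq c 0; last first.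
    by apply: (hwlog b a d c) => // x xX; rewrite fE // addrC.
  exists B, r, s; rewrite (capv_idPl _) //; apply/subvP => x xX.
  by rewrite memv_ker fE // c_eq0 d_eq0 !mul0r addr0.
have cut e : is_sign e -> (e != 0 -> (a \in B) && (a != b)) ->
    (forall x, x \in X -> (f x == 0) = (x ord0 b == e%:~R * x ord0 a)) ->
    sign_parametrizable (X :&: lker f).
  move=> es ea eE; do 3!eexists.
  exact: parametrized_cap_lker pX (db d0) es ea eE.
have d1 : d = 1 \/ d = -1 by case/or3P: ds d0 => /eqP ->; [|left|right].
have [ab|ab] := eqVneq a b; last first.
  apply: (cut (- (c * d))); first by apply/is_signN/is_signM.
    by rewrite oppr_eq0 mulf_eq0 negb_or => /andP[/ca -> _].
  move=> x xX; rewrite fE // mulrNz intrM.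
  case: d1 => ->; rewrite ?mulrNz mulr1z ?mulrN mulr1 ?mulNr ?opprK ?mul1r.
    by rewrite addrC addr_eq0.
  by rewrite subr_eq0 eq_sym.
have f_diag x : x \in X -> f x = (c + d)%:~R * x ord0 b.
  by move=> xX; rewrite fE // ab intrD mulrDl.
have [cd0|cd0] := eqVneq (c + d) 0.
  exists B, r, s; rewrite (capv_idPl _) //; apply/subvP => x xX.
  by rewrite memv_ker f_diag // cd0 mul0r.
apply: (cut 0) => // x xX.
by rewrite f_diag // mulf_eq0 intr_eq0 (negbTE cd0) mul0r.
Qed.

End NumField.
End SignParametrization.

Section Levels.
Local Open Scope ring_scope.
Variable m : nat.

(* The integers from [-m] to [m], shifted by [m]; negation is [rev_ord]. *)
Definition level := 'I_(2 * m).+1.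
Implicit Types a b : level.

Lemma rev_level_fixed a : (rev_ord a == a) = (a == inord m).
Proof.
rewrite -!val_eqE /= inordK; last by lia.
by have := ltn_ord a; lia.
Qed.

Lemma card_opp_free_levels n :
  #|[set s : n.-tuple level | opp_free (@rev_ord _) s]|
  = (colorings n 0 m 0 + n * colorings n.-1 0 m 0)%N.
Proof.
have fixed1 : #|[set a : level | rev_ord a == a]| = 1%N.
  rewrite -[RHS](cards1 (inord m : level)).
  by apply: eq_card => a; rewrite !inE rev_level_fixed.
rewrite (card_opp_free (@rev_ordK _) n (l := m) _ fixed1) ?colorings_singleS //.
have := cardsC [set a : level | rev_ord a == a].
rewrite card_ord fixed1 => -[cardN].
by rewrite -[RHS]cardN; apply: eq_card => a; rewrite !inE.
Qed.

Variable R : numDomainType.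

Definition level_val a : R := a%:R - m%:R.

Lemma level_val_rev a : level_val (rev_ord a) = - level_val a.
Proof.
rewrite /level_val [rev_ord _ : nat]subSS natrB -1?ltnS // natrM; ring.
Qed.

Lemma level_val_inj : injective level_val.
Proof. by move=> a b /addIr /eqP; rewrite eqr_nat => /eqP /val_inj. Qed.

Definition scale_level (c : int) a : level :=
  if c == 0 then inord m else if c == 1 then a else rev_ord a.

Lemma level_val_scale c a : is_sign c ->
  level_val (scale_level c a) = c%:~R * level_val a.
Proof.
move=> /or3P[]/eqP->; rewrite /scale_level /= ?mul1r ?mulN1r ?level_val_rev //.
by rewrite mul0r /level_val inordK ?subrr //; lia.
Qed.

End Levels.

Section ThresholdFlats.
Local Open Scope ring_scope.
Variables (R : realType) (n : nat).
Implicit Types (X H : {vspace 'rV[R]_n}).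

Lemma threshold_arrangementP H :
  reflect
    (exists2 p : 'I_n * 'I_n,
      (p.1 < p.2)%N & H = threshold_hyperplane R p.1 p.2)
    (H \in threshold_arrangement R n).
Proof. exact: (iffP (imfsetP _ _ _ _)). Qed.

Lemma fullv_notin_threshold_arrangement :
  fullv \notin threshold_arrangement R n.
Proof.
apply/threshold_arrangementP => -[[i j] /= ij fullE].
have := memvf (delta_mx ord0 i : 'rV[R]_n).
rewrite fullE mem_threshold_hyperplane !mxE !eqxx /=.
rewrite (_ : (j == i) = false) ?addr0 ?oner_eq0 //.
by apply/negbTE; rewrite -val_eqE /= neq_ltn ij orbT.
Qed.

Lemma sign_parametrizable_flat X :
  X \in flats (threshold_arrangement R n) -> sign_parametrizable X.
Proof.
move=> /flatsP[A /fsubsetP sA ->].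
have {sA} : {subset enum_fset A <= threshold_arrangement R n} by [].
elim: (enum_fset A) => [|H s IH] sA.
  by rewrite big_nil; exact: sign_parametrizable_full.
have [T Ts|B [r [u pX]]] := IH; first by apply: sA; rewrite in_cons Ts orbT.
have /threshold_arrangementP[[i j] _ ->] := sA H (mem_head _ _).
rewrite big_cons capvC; have [_ sign_u rep_r memX _] := pX.
apply: (sign_parametrizable_cap_lker pX (sign_u i) (sign_u j)
  (rep_r i) (rep_r j)) => x.
rewrite memX => /forallP xX; rewrite lfunE /= /coord_sum.
by rewrite -(eqP (xX i)) -(eqP (xX j)).
Qed.

Section Box.
Variable m : nat.

Definition box_point (p : n.-tuple (level m)) : 'rV[R]_n :=
  \row_i level_val R (tnth p i).

Lemma mem_box_point X B r s (p : n.-tuple (level m)) : parametrized X B r s ->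
  (box_point p \in X)
  = [forall i, tnth p i == scale_level (s i) (tnth p (r i))].
Proof.
move=> [_ sign_s _ -> _]; apply: eq_forallb => i.
rewrite !mxE -level_val_scale //.
by rewrite (inj_eq (@level_val_inj _ _)).
Qed.

Lemma card_box_flat X : X \in flats (threshold_arrangement R n) ->
  #|[set p | box_point p \in X]| = ((2 * m).+1 ^ \dim X)%N.
Proof.
move=> /sign_parametrizable_flat[B [r [s pX]]].
have [free_s _ rep_r _ ->] := pX.
pose extend (g : {ffun 'I_n -> level m}) :=
  [tuple scale_level (s i) (g (r i)) | i < n].
have extendB g i : i \in B -> tnth (extend g) i = g i.
  by move=> /free_s[ri si]; rewrite tnth_mktuple ri si.
have -> : [set p | box_point p \in X] =
    extend @: [set g in pffun_on ord0 (mem B) predT].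
  apply/setP => p; rewrite inE (mem_box_point p pX).
  apply/forallP/imsetP => [pE|[g _ -> i]].
    exists [ffun i => if i \in B then tnth p i else ord0].
      rewrite inE; apply/pffun_onP; split => //.
      by apply/subsetP => i; rewrite !inE ffunE; case: ifP; rewrite ?eqxx.
    apply: eq_from_tnth => i; rewrite tnth_mktuple ffunE (eqP (pE i)).
    by case: ifP => // rB; case: (eqVneq (s i) 0) => [->//|/rep_r]; rewrite rB.
  rewrite {1}tnth_mktuple; case: (eqVneq (s i) 0) => [->//|/rep_r rB].
  by rewrite extendB.
rewrite card_in_imset ?cardsE ?card_pffun_on ?card_ord // => g h.
rewrite !inE => /pffun_onP[gB _] /pffun_onP[hB _] gh.
apply/ffunP => i; case: (boolP (i \in B)) => iB.
  by rewrite -!extendB // gh.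
by rewrite (supportP gB) ?(supportP hB).
Qed.

Lemma box_point_notin_hyperplane (p : n.-tuple (level m)) (i j : 'I_n) :
  (box_point p \notin threshold_hyperplane R i j)
  = (rev_ord (tnth p j) != tnth p i).
Proof.
rewrite mem_threshold_hyperplane !mxE addr_eq0 -level_val_rev.
by rewrite (inj_eq (@level_val_inj _ _)) eq_sym.
Qed.

Lemma arr_char_poly_threshold :
  (arr_char_poly (threshold_arrangement R n)).[(2 * m).+1%:Z]
  = (colorings n 0 m 0 + n * colorings n.-1 0 m 0)%N%:Z.
Proof.
rewrite (arr_char_poly_count fullv_notin_threshold_arrangement card_box_flat).
rewrite -card_opp_free_levels; congr Posz; apply: eq_card => p; rewrite !inE.
apply/allP/(pairwiseP ord0) => [pA i j|pP H].
  rewrite !inE size_tuple => ilt jlt ij.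
  rewrite -(tnth_nth _ _ (Ordinal ilt)) -(tnth_nth _ _ (Ordinal jlt)).
  rewrite -box_point_notin_hyperplane; apply: pA.
  by apply/threshold_arrangementP; exists (Ordinal ilt, Ordinal jlt).
move=> /threshold_arrangementP[[i j] /= ij ->].
rewrite box_point_notin_hyperplane !(tnth_nth ord0).
by apply: pP; rewrite ?inE ?size_tuple.
Qed.

End Box.
End ThresholdFlats.

(** * Canonical words *)

(* A label and a sign. *)
Local Notation letter := (nat * bool)%type.
Local Notation letter0 := (0, false).

Section Words.
Implicit Types (x y : letter) (u : seq letter) (S : seq nat) (p s : bool).

(* A word is canonical if it is sorted for this relation. *)
Definition may_follow x y : bool := (y.2 != x.2) || (x.1 <= y.1).

Lemma sorted_may_follow s u : sorted may_follow u = path may_follow (0, s) u.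
Proof. by case: u => //= x u; rewrite /may_follow leq0n orbT. Qed.

Definition label u i : nat := (nth letter0 u i).1.
Definition sign u i : bool := (nth letter0 u i).2.

(* Letters whose label is smaller than all later ones are the anchors, and [p]
   is the sign of the previous anchor; [p = false] counts the odd anchors. *)
Fixpoint sign_changes p u : nat :=
  if u is x :: u' then
    if all (fun y => x.1 < y.1) u' then (p != x.2) + sign_changes x.2 u'
    else sign_changes p u'
  else 0.

Definition letters S : seq letter :=
  [seq (v, s) | v <- S, s <- [:: true; false]].

Lemma mem_letters S x : (x \in letters S) = (x.1 \in S).
Proof.
apply/allpairsP/idP => [[[v s] /= [vS _ ->]] //|xS].
by exists x; case: x xS => v [].
Qed.

Fixpoint canonical_words k S x : seq (seq letter) :=
  if k is k'.+1 then
    [seq y :: u | y <- [seq y <- letters S | may_follow x y],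
                  u <- canonical_words k' (rem y.1 S) y]
  else [:: [::]].

Lemma mem_canonical_words k S x u : size S = k ->
  (u \in canonical_words k S x) = perm_eq (unzip1 u) S && path may_follow x u.
Proof.
elim: k S x u => [|k IH] S x u szS.
  rewrite (size0nil szS) /= inE; case: u => [|y u] //.
  by apply/esym/negbTE; apply: contraTN isT => /andP[/perm_size].
apply/allpairsPdep/andP => [[y [w []]]|].
  rewrite mem_filter mem_letters => /andP[xy yS].
  rewrite IH ?size_rem ?szS // => /andP[pw yw] -> /=; rewrite xy yw.
  split=> //; rewrite perm_sym; apply: perm_trans (perm_to_rem yS) _.
  by rewrite perm_cons perm_sym.
case: u => [[/perm_size]|y u /= [pu /andP[xy yu]]]; first by rewrite szS.
have yS : y.1 \in S by rewrite -(perm_mem pu) mem_head.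
exists y, u; split; rewrite ?mem_filter ?mem_letters ?xy //.
rewrite IH ?size_rem ?szS // yu andbT.
by rewrite -(perm_cons y.1); apply: perm_trans pu (perm_to_rem yS).
Qed.

Lemma uniq_canonical_words k S x : uniq S -> uniq (canonical_words k S x).
Proof.
elim: k S x => [|k IH] S x uS //=.
apply: allpairs_uniq_dep => [|y _|].
- by apply/filter_uniq/allpairs_uniq => // -[v s] [v' s'] _ _ [-> ->].
- by apply/IH/rem_uniq.
- by move=> [y u] [y' u'] _ _ /= [-> ->].
Qed.

Lemma big_canonical_words (V : nmodType) k S x (P : pred (seq letter))
    (f : seq letter -> V) :
  (\sum_(u <- canonical_words k.+1 S x | P u) f u =
   \sum_(v <- S) \sum_(s <- [:: true; false])
     if may_follow x (v, s) then
       \sum_(u <- canonical_words k (rem v S) (v, s) | P ((v, s) :: u))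
         f ((v, s) :: u)
     else 0)%R.
Proof.
rewrite big_mkcond big_allpairs_dep big_filter big_mkcond /letters big_allpairs.
apply: eq_bigr => v _; apply: eq_bigr => s _.
by case: ifP => // _; rewrite -big_mkcond.
Qed.

Definition rank S (v : nat) : nat := count (fun a => a < v) S.

Lemma leq_rank S v a : v \in S -> (rank S a <= rank S v) = (a <= v).
Proof.
move=> vS; case: (leqP a v) => va.
  by apply: sub_count => b /= /leq_trans; apply.
have rankE c : rank S c = (v < c) + rank (rem v S) c.
  by rewrite /rank (seq.permP (perm_to_rem vS)).
apply/negbTE; rewrite -ltnNge !rankE ltnn va ltnS.
by apply: sub_count => b /= /ltn_trans; apply.
Qed.

Lemma rank_rem S v : v \in S -> rank (rem v S) v = rank S v.
Proof. by move=> vS; rewrite /rank (seq.permP (perm_to_rem vS)) /= ltnn. Qed.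

Lemma rank_eq0 S v : (rank S v == 0) = all (leq v) S.
Proof.
rewrite -leqn0 leqNgt -has_count -all_predC.
by apply: eq_all => a /=; rewrite -leqNgt.
Qed.

Lemma sum_rank (V : nmodType) S (g : nat -> V) : uniq S ->
  (\sum_(v <- S) g (rank S v) = \sum_(0 <= k < size S) g k)%R.
Proof.
move=> uS; rewrite -(big_map (rank S) xpredT g) /index_iota subn0.
apply: perm_big; have u_ranks : uniq (map (rank S) S).
  rewrite map_inj_in_uniq // => v a vS aS eq_rank; apply/eqP.
  by rewrite eqn_leq -(leq_rank v aS) -(leq_rank a vS) eq_rank leqnn.
apply: uniq_perm; rewrite ?iota_uniq //.
have [||] := uniq_min_size u_ranks (s2 := iota 0 (size S)); last by [].
  move=> r /mapP[v vS ->]; rewrite mem_iota /= add0n /rank.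
  rewrite ltn_neqAle count_size andbT -all_count.
  by apply/allPn; exists v => //; rewrite /= ltnn.
by rewrite size_iota size_map.
Qed.

Lemma all_gt_canonical_word k S x u v : size S = k -> v \notin S ->
  u \in canonical_words k S x -> all (fun y => v < y.1) u = (rank S v == 0).
Proof.
move=> szS vS; rewrite mem_canonical_words // => /andP[pu _].
rewrite rank_eq0 -(perm_all _ pu) all_map; apply: eq_in_all => y yu /=.
rewrite ltn_neqAle; case: eqP => //= vy; case/negP: vS.
by rewrite vy -(perm_mem pu) map_f.
Qed.

Section Sums.
Local Open Scope ring_scope.
Variables (R : comNzRingType) (t : R).

Definition weight p k S x : R :=
  \sum_(u <- canonical_words k S x) t ^+ sign_changes p u.

Lemma sum_sign_changes_cons p k S v s : uniq S -> size S = k.+1 -> v \in S ->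
  \sum_(u <- canonical_words k (rem v S) (v, s))
    t ^+ sign_changes p ((v, s) :: u)
  = if rank S v == 0%N then t ^+ (p != s) * weight s k (rem v S) (v, s)
    else weight p k (rem v S) (v, s).
Proof.
move=> uS szS vS; have szR : size (rem v S) = k by rewrite size_rem // szS.
have vR : v \notin rem v S by rewrite mem_rem_uniq // inE eqxx.
rewrite /weight; case: ifP => r0; rewrite ?big_distrr;
  apply: eq_big_seq => u uc /=;
  by rewrite (all_gt_canonical_word szR vR uc) rank_rem // r0 ?exprD.
Qed.

Lemma weightE k S x p : uniq S -> size S = k ->
  weight p k S x = word_sum t k (rank S x.1) (x.2 == p).
Proof.
elim: k S x p => [|k IH] S x p uS szS; first by rewrite /weight big_seq1.
have head_sum v s : v \in S ->
    \sum_(u <- canonical_words k (rem v S) (v, s))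
      t ^+ sign_changes p ((v, s) :: u)
    = head_weight t (word_sum t k) (rank S v) (s == p).
  move=> vS; have szR : size (rem v S) = k by rewrite size_rem // szS.
  rewrite sum_sign_changes_cons // !IH ?rem_uniq // rank_rem //.
  rewrite /head_weight eqxx.
  by case: eqP => //= ->; rewrite eq_sym; case: (s == p).
rewrite /weight big_canonical_words word_sumS -szS -sum_rank //.
apply: eq_big_seq => v vS; rewrite big_cons big_seq1 leq_rank // !head_sum //.
rewrite /may_follow /=.
by case: x.2; case: p {head_sum} => /=; case: leqP;
  rewrite ?mul0r ?mul1r ?addr0 ?add0r //= addrC.
Qed.

Lemma weight_opposite k S x p : uniq S -> size S = k.+1 ->
  \sum_(u <- canonical_words k.+1 S x | sign u 0 != x.2) t ^+ sign_changes p u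
  = word_sum t k.+1 k.+1 (x.2 == p).
Proof.
(* Only a letter of opposite sign may follow a label exceeding all of [S]. *)
move=> uS szS; have [top lt_top] : exists top, forall v, v \in S -> (v < top)%N.
  by exists (\max_(v <- S) v).+1 => v vS; rewrite ltnS leq_bigmax_seq.
have rank_top : rank S top = k.+1.
  by rewrite -szS; apply/eqP; rewrite -all_count; apply/allP.
rewrite -[X in word_sum _ _ X _]rank_top -(@weightE _ _ (top, x.2)) //.
rewrite /weight !big_canonical_words.
apply: eq_big_seq => v vS; apply: eq_bigr => s _.
rewrite /may_follow /sign /= (leqNgt top) lt_top // orbF.
by case: eqP => //= _; case: ifP => // _; rewrite big_pred0_eq.
Qed.

Lemma weight_same k S x p : uniq S -> size S = k.+1 ->
  \sum_(u <- canonical_words k.+1 S x | sign u 0 == x.2) t ^+ sign_changes p u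
  = word_sum t k.+1 (rank S x.1) (x.2 == p) - word_sum t k.+1 k.+1 (x.2 == p).
Proof.
move=> uS szS; rewrite -weightE // -(@weight_opposite k S x) // /weight.
by rewrite [in RHS](bigID (fun u => sign u 0 == x.2)) /= addrK.
Qed.

(* Standard words are the canonical words with this property. *)
Definition same_first_signs u : bool := sign u 1 == sign u 0.

(* In a standard word the label 0 lies in the first block iff it comes first;
   the convention then adds it with sign +, whatever its sign in the word. *)
Definition odd_stat u : nat :=
  if label u 0 == 0%N then (sign_changes true (behead u)).+1
  else sign_changes false u.

Lemma sum_odd_stat_head k S v :
  uniq S -> size S = k.+2 -> 0%N \in S -> v \in S ->
  \sum_(s <- [:: true; false])
    \sum_(u <- canonical_words k.+1 (rem v S) (v, s) | sign u 0 == s)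
      t ^+ odd_stat ((v, s) :: u)
  = head_weight t (word_sum t k.+1) (rank S v) true
    + head_weight t (word_sum t k.+1) (rank S v) false - word_sum t k.+1 0 true.
Proof.
move=> uS szS S0 vS; have uR := rem_uniq v uS.
have szR : size (rem v S) = k.+1 by rewrite size_rem // szS.
have r0 : (rank S v == 0%N) = (v == 0%N).
  rewrite rank_eq0; apply/allP/eqP => [/(_ 0%N S0)|-> //].
  by rewrite leqn0 => /eqP.
rewrite big_cons big_seq1 /head_weight r0 /odd_stat /label /=.
rewrite -(word_sum_rank_maxD t k).
case: eqP => v0.
  have zero_head s :
      \sum_(u <- canonical_words k.+1 (rem v S) (v, s) | sign u 0 == s)
        t ^+ (sign_changes true u).+1 =
      t * (word_sum t k.+1 0 true - word_sum t k.+1 k.+1 s).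
    under eq_bigr do rewrite exprS.
    rewrite -big_distrr (@weight_same _ _ (v, s)) //= v0 /rank count_pred0.
    by rewrite word_sum_rank0 eqb_id.
  rewrite !zero_head -word_sum_rank_maxD; ring.
have vR : v \notin rem v S by rewrite mem_rem_uniq // inE eqxx.
have nonzero_head s :
    \sum_(u <- canonical_words k.+1 (rem v S) (v, s) | sign u 0 == s)
      t ^+ sign_changes false ((v, s) :: u) =
    word_sum t k.+1 (rank S v) (s == false) - word_sum t k.+1 k.+1 (s == false).
  rewrite -(rank_rem vS) -(@weight_same _ _ (v, s)) //.
  rewrite big_seq_cond [RHS]big_seq_cond; apply: eq_bigr => u /andP[uc _] /=.
  by rewrite (all_gt_canonical_word szR vR uc) rank_rem // r0; case: eqP.
rewrite !nonzero_head /=; ring.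
Qed.

Lemma sum_odd_stat k S x : uniq S -> size S = k.+2 -> 0%N \in S -> x.1 = 0%N ->
  \sum_(u <- canonical_words k.+2 S x | same_first_signs u) t ^+ odd_stat u
  = word_sum t k.+2 0 true - k.+2%:R * word_sum t k.+1 0 true.
Proof.
move=> uS szS S0 x0; rewrite big_canonical_words.
pose g r := head_weight t (word_sum t k.+1) r true
  + head_weight t (word_sum t k.+1) r false - word_sum t k.+1 0 true.
transitivity (\sum_(v <- S) g (rank S v)).
  apply: eq_big_seq => v vS; rewrite /g -(sum_odd_stat_head uS szS S0 vS).
  by apply: eq_bigr => s _; rewrite /may_follow x0 orbT.
rewrite sum_rank // szS /g big_split /= sumr_const_nat subn0 mulNrn.
rewrite -(mulr_natl (word_sum _ _ _ _)); congr (_ - _).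
by rewrite [RHS]word_sumS; apply: eq_bigr => r _; rewrite mul1r addrC.
Qed.

End Sums.
End Words.

(** * Threshold graphs of words *)

Section WordGraphs.
Implicit Types (x y z : letter) (u w : seq letter) (p s : bool).
Implicit Types a b i j k : nat.

(* [a] and [b] are adjacent iff the one occurring later has sign +. *)
Fixpoint word_adj u a b : bool :=
  if u is x :: u' then
    [|| (a == x.1) && ((b, true) \in u'), (b == x.1) && ((a, true) \in u')
      | word_adj u' a b]
  else false.

Lemma word_adj_sym u a b : word_adj u a b = word_adj u b a.
Proof. by elim: u => //= x u ->; rewrite orbCA. Qed.

Lemma word_adj_mem u a b :
  word_adj u a b -> (a \in unzip1 u) && (b \in unzip1 u).
Proof.
elim: u => //= x u IH; rewrite !inE.
move=> /or3P[/andP[-> bu]|/andP[-> au]|/IH/andP[-> ->]].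
- by rewrite (map_f fst bu) orbT.
- by rewrite (map_f fst au) orbT.
- by rewrite !orbT.
Qed.

Lemma word_adj_rcons u x a b : word_adj (rcons u x) a b =
  word_adj u a b ||
  x.2 && ((a == x.1) && (b \in unzip1 u) || (b == x.1) && (a \in unzip1 u)).
Proof.
case: x => v s; elim: u => [|y u IH] /=; first by rewrite !andbF.
rewrite {}IH !mem_rcons !inE !xpair_eqE /=.
by case: s; do !case: (_ == _) => //=; do !case: (_ \in _) => //=;
  rewrite ?orbT ?orbF.
Qed.

Lemma word_adj_belast u x a b : uniq (unzip1 (rcons u x)) ->
  word_adj u a b = [&& a != x.1, b != x.1 & word_adj (rcons u x) a b].
Proof.
rewrite /unzip1 map_rcons rcons_uniq => /andP[xu _]; rewrite word_adj_rcons.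
case: eqP => [->|_] /=.
  by apply/negbTE; apply: contraNN xu => /word_adj_mem/andP[].
by case: eqP => [->|_]; rewrite ?andbF ?orbF //; apply/negbTE;
  apply: contraNN xu => /word_adj_mem/andP[].
Qed.

Lemma word_adj_consl x u w : u =i w -> word_adj u =2 word_adj w ->
  word_adj (x :: u) =2 word_adj (x :: w).
Proof. by move=> uw adj a b /=; rewrite !uw adj. Qed.

Lemma word_adj_swap x y u : x.2 = y.2 ->
  word_adj (x :: y :: u) =2 word_adj (y :: x :: u).
Proof.
case: x y => [v s] [v' s'] /= -> a b; rewrite !inE !xpair_eqE.
by case: s'; do !case: (_ == _) => //=; do !case: (_ \in _).
Qed.

Lemma sign_changes_consl x u w : perm_eq u w ->
  sign_changes^~ u =1 sign_changes^~ w ->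
  sign_changes^~ (x :: u) =1 sign_changes^~ (x :: w).
Proof. by move=> uw sc p /=; rewrite (perm_all _ uw) !sc. Qed.

Lemma sign_changes_swap p x y u : x.2 = y.2 -> y.1 < x.1 ->
  sign_changes p (x :: y :: u) = sign_changes p (y :: x :: u).
Proof.
case: x y => [v s] [v' s'] /= -> lt; rewrite lt ltnNge (ltnW lt) /=.
case: ifP => [_|nall]; first by rewrite eqxx; case: ifP.
case: ifP => // /allP all_gt; case/allP: (negbT nall) => z zu.
exact: ltn_trans lt (all_gt z zu).
Qed.

Fixpoint insert x u :=
  if u is y :: u' then
    if (x.2 == y.2) && (y.1 < x.1) then y :: insert x u' else x :: u
  else [:: x].

Lemma perm_insert x u : perm_eq (insert x u) (x :: u).
Proof.
elim: u => //= y u IH; case: ifP => // _.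
rewrite -(perm_cons y) in IH; apply: perm_trans IH _.
exact: permEl (perm_catCA [:: y] [:: x] u).
Qed.

Lemma word_adj_insert x u : word_adj (insert x u) =2 word_adj (x :: u).
Proof.
elim: u => // y u IH; rewrite [insert _ _]/=.
case: ifP => // /andP[/eqP xy _] a b.
by rewrite (word_adj_consl y (perm_mem (perm_insert x u)) IH) word_adj_swap.
Qed.

Lemma sign_changes_insert x u p :
  sign_changes p (insert x u) = sign_changes p (x :: u).
Proof.
elim: u p => // y u IH p; rewrite [insert _ _]/=.
case: ifP => // /andP[/eqP xy lt].
by rewrite (sign_changes_consl y (perm_insert x u) IH) [RHS]sign_changes_swap.
Qed.

Lemma path_insert z x u : may_follow z x ->
  path may_follow z u -> path may_follow z (insert x u).
Proof.
elim: u z => [|y u IH] z zx /=; first by rewrite zx.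
move=> /andP[zy yu]; case: ifP => [/andP[/eqP xy lt]|];
  rewrite /= ?zy ?zx ?yu ?andbT /=.
  by apply: IH => //; rewrite /may_follow (ltnW lt) orbT.
by move/negbT; rewrite negb_and -leqNgt eq_sym.
Qed.

Lemma insert_label0 x u : x.1 = 0 -> insert x u = x :: u.
Proof. by case: u => //= y u ->; rewrite ltn0 andbF. Qed.

Lemma sign0_insert x u : sign (insert x u) 0 = x.2.
Proof. by case: u => //= y u; case: ifP => // /andP[/eqP]. Qed.

Lemma same_first_signs_insert x u : u != [::] -> sign u 0 = x.2 ->
  same_first_signs (insert x u).
Proof.
rewrite /same_first_signs; case: u => // y u _ /= yx.
case: ifP => [/andP[/eqP xy _]|_] /=; last exact/eqP.
by rewrite -[sign _ 1]/(sign (insert x u) 0) sign0_insert xy; exact/eqP.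
Qed.

(* Sorting within the blocks: letters of opposite signs are never exchanged. *)
Definition word_sort u := foldr insert [::] u.

Lemma perm_word_sort u : perm_eq (word_sort u) u.
Proof.
elim: u => //= x u IH; apply: perm_trans (perm_insert _ _) _.
by rewrite perm_cons.
Qed.

Lemma word_adj_sort u : word_adj (word_sort u) =2 word_adj u.
Proof.
elim: u => //= x u IH a b; rewrite word_adj_insert.
exact: word_adj_consl (perm_mem (perm_word_sort u)) IH a b.
Qed.

Lemma sign_changes_sort u p : sign_changes p (word_sort u) = sign_changes p u.
Proof.
elim: u p => // x u IH p; rewrite [word_sort _]/= sign_changes_insert.
exact: sign_changes_consl (perm_word_sort u) IH p.
Qed.

Lemma sorted_word_sort u : sorted may_follow (word_sort u).
Proof.
rewrite (sorted_may_follow false); elim: u => //= x u IH.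
by apply: path_insert => //; rewrite /may_follow orbT.
Qed.

(* The sign of the first letter does not affect the graph; [retype] copies the
   sign of the second letter onto it. *)
Definition retype u := if u is x :: y :: u' then [:: (x.1, y.2), y & u'] else u.

Definition standardize u := word_sort (retype u).

Lemma perm_standardize u : perm_eq (unzip1 (standardize u)) (unzip1 u).
Proof.
have <- : unzip1 (retype u) = unzip1 u by case: u => [|x [|y u]].
exact/perm_map/perm_word_sort.
Qed.

Lemma word_adj_standardize u : word_adj (standardize u) =2 word_adj u.
Proof. by move=> a b; rewrite word_adj_sort; case: u => [|x [|y u]]. Qed.

Lemma same_first_signs_standardize u :
  1 < size u -> same_first_signs (standardize u).
Proof.
case: u => [|x [|y u]] // _.
apply: same_first_signs_insert; last exact: sign0_insert.
by rewrite -size_eq0 (perm_size (perm_insert _ _)).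
Qed.

Lemma label_nth u i : i < size u -> label u i = nth 0 (unzip1 u) i.
Proof. by move=> ui; rewrite (nth_map letter0). Qed.

Lemma label_inj u i j : uniq (unzip1 u) -> i < size u -> j < size u ->
  label u i = label u j -> i = j.
Proof.
move=> uu ui uj eq_ij; apply/eqP.
by rewrite -(nth_uniq 0 _ _ uu) ?size_map // -!label_nth // eq_ij.
Qed.

Lemma mem_labelP u a :
  reflect (exists2 i, i < size u & a = label u i) (a \in unzip1 u).
Proof.
apply: (iffP (nthP 0)); rewrite size_map => -[i ui ai]; exists i => //.
  by rewrite label_nth.
by rewrite ai label_nth.
Qed.

Lemma word_adjP u a b : reflect
  (exists i k, [/\ i < k, k < size u, sign u k &
     (a, b) = (label u i, label u k) \/ (b, a) = (label u i, label u k)])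
  (word_adj u a b).
Proof.
apply: (iffP idP).
  elim: u => //= x u IH.
  case/or3P => [/andP[/eqP -> bu]|/andP[/eqP -> au]|/IH[i [k [ik ku sk ab]]]].
  - exists 0, (index (b, true) u).+1; rewrite /label /sign /= nth_index //.
    by split; rewrite ?ltnS ?index_mem //; left.
  - exists 0, (index (a, true) u).+1; rewrite /label /sign /= nth_index //.
    by split; rewrite ?ltnS ?index_mem //; right.
  - by exists i.+1, k.+1.
elim: u => [|x u IH] [i [k [ik ku sk ab]]] //.
case: k ik ku sk ab => // k ik ku sk ab.
case: i ik ab => [_|i ik] ab; last by apply/or3P/Or33/IH; exists i, k.
have mem_k : (label u k, true) \in u.
  by rewrite -[true]sk -surjective_pairing mem_nth.
by case: ab => -[-> ->] /=; rewrite eqxx mem_k ?orbT.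
Qed.

Lemma word_adj_label u i k : uniq (unzip1 u) -> i < k < size u ->
  word_adj u (label u i) (label u k) = sign u k.
Proof.
move=> uu /andP[ik ku]; have iu := ltn_trans ik ku.
apply/word_adjP/idP => [[j [l [jl lu sl eq_labels]]]|sk]; last first.
  by exists i, k; split=> //; left.
have ju := ltn_trans jl lu.
case: eq_labels => -[]; first by move=> _ /(label_inj uu ku lu) ->.
by move=> /(label_inj uu ku ju) kj /(label_inj uu iu lu) il; lia.
Qed.

Definition standard u :=
  [&& uniq (unzip1 u), sorted may_follow u & same_first_signs u].

Lemma sorted_label_leq u i k : sorted may_follow u -> i <= k < size u ->
  (forall j, i <= j <= k -> sign u j = sign u i) -> label u i <= label u k.
Proof.
move=> /(sortedP letter0) su; elim: k => [|k IH] /andP[ik ku] const.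
  by move: ik; rewrite leqn0 => /eqP ->.
move: ik; rewrite leq_eqVlt => /predU1P[<- //|ik].
apply: leq_trans (IH _ _) _; first by rewrite -ltnS ik ltnW.
  by move=> j /andP[ij jk]; apply: const; rewrite ij leqW.
have sign_k : sign u k = sign u i by apply: const; lia.
have sign_Sk : sign u k.+1 = sign u i by apply: const; lia.
by have /orP[/eqP[]|] := su k ku; first exact: etrans sign_Sk (esym sign_k).
Qed.

Lemma mem_last_label u : 0 < size u -> (last letter0 u).1 \in unzip1 u.
Proof. by case: u => // x u _; exact: (map_f fst (mem_last x u)). Qed.

Lemma word_adj_last u b : uniq (unzip1 u) -> b \in unzip1 u ->
  b != (last letter0 u).1 ->
  word_adj u (last letter0 u).1 b = (last letter0 u).2.
Proof.
move=> uu /mem_labelP[i ui ->].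
rewrite -nth_last -/(label u _) -/(sign u _) => ib.
have /orP[/eqP i_last|i_lt] : (i == (size u).-1) || (i < (size u).-1) by lia.
  by rewrite i_last eqxx in ib.
by rewrite word_adj_sym word_adj_label // i_lt; lia.
Qed.

(* A vertex adjacent to all the others, or to none of them, belongs to the
   last block, where labels increase. *)
Lemma leq_last_label u a : standard u -> a \in unzip1 u ->
  (forall b, b \in unzip1 u -> b != a -> word_adj u a b = (last letter0 u).2) ->
  a <= (last letter0 u).1.
Proof.
move=> /and3P[uu su /eqP ssu] /mem_labelP[i ui ->]; rewrite -nth_last.
set m := (size u).-1; rewrite -/(label u m) -/(sign u m) => adj_i.
have adjE j : j < size u -> j != i ->
    word_adj u (label u i) (label u j) = sign u m.
  move=> uj ji; apply: adj_i; first by apply/mem_labelP; exists j.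
  by apply: contraNneq ji => /label_inj ->.
have later j : i < j < size u -> sign u j = sign u m.
  by move=> ijs; rewrite -(word_adj_label uu ijs) adjE //; lia.
have sign_i : sign u i = sign u m.
  case: i ui adj_i adjE later => [|i] ui adj_i adjE later.
    have [m0|m0] := posnP m; first by rewrite m0.
    by rewrite -ssu; apply: later; rewrite /m in m0; lia.
  by rewrite -(word_adj_label uu (i := 0)) ?ui // word_adj_sym adjE //; lia.
apply: (sorted_label_leq su) => [|j /andP[]]; first by rewrite /m; lia.
rewrite leq_eqVlt => /predU1P[<- //|ij jm].
by rewrite sign_i later // ij /=; rewrite /m in jm; lia.
Qed.

Section SameGraph.
Variables u w : seq letter.
Hypotheses (std_u : standard u) (std_w : standard w).
Hypothesis perm_uw : perm_eq (unzip1 u) (unzip1 w).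
Hypothesis adj_uw : word_adj u =2 word_adj w.

Lemma eq_last_sign : 1 < size u -> (last letter0 u).2 = (last letter0 w).2.
Proof.
move=> u1; have [[uu _ _] [uw _ _]] := (and3P std_u, and3P std_w).
have w1 : 1 < size w by rewrite -(size_map fst w) -(perm_size perm_uw) size_map.
have head_mem : label u 0 \in unzip1 u.
  by apply/mem_labelP; exists 0 => //; exact: ltnW.
have [eq_last|neq_last] :=
    eqVneq (last letter0 u).1 (last letter0 w).1; last first.
  rewrite -(word_adj_last uu (b := (last letter0 w).1)); last by rewrite eq_sym.
    rewrite adj_uw word_adj_sym word_adj_last // -(perm_mem perm_uw).
    exact: mem_last_label (ltnW u1).
  by rewrite (perm_mem perm_uw) (mem_last_label (ltnW w1)).
have neq_head : label u 0 != (last letter0 u).1.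
  by rewrite -nth_last; apply/eqP => /(label_inj uu); lia.
rewrite -(word_adj_last uu head_mem neq_head) adj_uw eq_last word_adj_last //.
  by rewrite -(perm_mem perm_uw).
by rewrite -eq_last.
Qed.

Lemma leq_last_label_same_graph :
  1 < size u -> (last letter0 u).1 <= (last letter0 w).1.
Proof.
move=> u1; have [uu _ _] := and3P std_u.
apply: leq_last_label => //.
  by rewrite -(perm_mem perm_uw) (mem_last_label (ltnW u1)).
move=> b.
by rewrite -(perm_mem perm_uw) -adj_uw -eq_last_sign //; exact: word_adj_last.
Qed.

End SameGraph.

Lemma eq_last_same_graph u w : standard u -> standard w ->
  perm_eq (unzip1 u) (unzip1 w) -> word_adj u =2 word_adj w ->
  1 < size u -> last letter0 u = last letter0 w.
Proof.
move=> su sw uw adj u1; rewrite [LHS]surjective_pairing [RHS]surjective_pairing.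
have wu : perm_eq (unzip1 w) (unzip1 u) by rewrite perm_sym.
have w1 : 1 < size w by rewrite -(size_map fst w) (perm_size wu) size_map.
rewrite (eq_last_sign su sw uw adj u1); congr pair; apply/eqP; rewrite eqn_leq.
by rewrite !leq_last_label_same_graph // => a b; rewrite adj.
Qed.

Lemma standard_belast u x : 1 < size u -> standard (rcons u x) -> standard u.
Proof.
rewrite /standard /unzip1 map_rcons rcons_uniq => u1 /and3P[/andP[_ ->] sx].
rewrite -cats1 in sx; have [-> _] := cat_sorted2 sx => ssx.
by case: u u1 ssx {sx} => [|y [|z u]].
Qed.

Lemma standard_word_inj u w : 1 < size u -> standard u -> standard w ->
  perm_eq (unzip1 u) (unzip1 w) -> word_adj u =2 word_adj w -> u = w.
Proof.
elim/last_ind: u w => // u x IH w u1 su sw uw adj.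
have := eq_last_same_graph su sw uw adj u1; rewrite last_rcons.
case/lastP: w sw uw adj => [|w y] sw uw adj.
  by have := perm_size uw; rewrite !size_map size_rcons.
rewrite last_rcons => xy; rewrite -{y}xy in sw uw adj *; congr rcons.
have perm_belast : perm_eq (unzip1 u) (unzip1 w).
  by move: uw; rewrite /unzip1 !map_rcons -!cats1 perm_cat2r.
have size_uw : size u = size w.
  by have := perm_size perm_belast; rewrite !size_map.
rewrite size_rcons ltnS leq_eqVlt in u1; case/predU1P: u1 => [u_eq1|u1].
  case: u u_eq1 su perm_belast size_uw {IH uw adj} => [|y []] // _ su perm_yw.
  case: w sw perm_yw => [|z []] // /and3P[_ _ /eqP sz] /perm_mem/(_ y.1).
  rewrite !inE eqxx => /esym/eqP yz _; case/and3P: su => _ _ /eqP sy.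
  by rewrite [y]surjective_pairing [z]surjective_pairing yz -[y.2]sy -[z.2]sz.
apply: IH => //; try by apply: (@standard_belast _ x); rewrite -?size_uw.
have [[uniq_u _ _] [uniq_w _ _]] := (and3P su, and3P sw).
move=> a b.
by rewrite (word_adj_belast _ _ uniq_u) (word_adj_belast _ _ uniq_w) adj.
Qed.

End WordGraphs.

(** * Constructions of threshold graphs *)

Lemma eq_set2 (T : finType) (a b c d : T) : [set a; b] = [set c; d] ->
  (a = c /\ b = d) \/ (a = d /\ b = c).
Proof.
move=> eq_set; have /set2P a_cd : a \in [set c; d] by rewrite -eq_set set21.
have /set2P b_cd : b \in [set c; d] by rewrite -eq_set set22.
have /set2P c_ab : c \in [set a; b] by rewrite eq_set set21.
have /set2P d_ab : d \in [set a; b] by rewrite eq_set set22.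
by case: a_cd b_cd c_ab d_ab => ? [] ? [] ? [] ?; subst; auto.
Qed.

Section WordOfConstruction.
Variable n : nat.
Implicit Types (c : signed_perm n) (u w : seq letter) (i k : 'I_n).

Definition step_letter c i : letter := (c.1 i : nat, c.2 i).

Definition word_of c : seq letter := [seq step_letter c i | i <- enum 'I_n].

Definition full_word u := perm_eq (unzip1 u) (iota 0 n).

Lemma size_word_of c : size (word_of c) = n.
Proof. by rewrite size_map size_enum_ord. Qed.

Lemma nth_word_of c i : nth letter0 (word_of c) i = step_letter c i.
Proof. by rewrite (nth_map i) ?size_enum_ord // nth_ord_enum. Qed.

Lemma label_word_of c i : label (word_of c) i = c.1 i.
Proof. by rewrite /label nth_word_of. Qed.

Lemma sign_word_of c i : sign (word_of c) i = c.2 i.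
Proof. by rewrite /sign nth_word_of. Qed.

Lemma uniq_full_word u : full_word u -> uniq (unzip1 u).
Proof. by move=> /perm_uniq ->; exact: iota_uniq. Qed.

Lemma size_full_word u : full_word u -> size u = n.
Proof. by move=> /perm_size; rewrite size_map size_iota. Qed.

Lemma mem_full_word u a : full_word u -> (a \in unzip1 u) = (a < n).
Proof. by move=> /perm_mem ->; rewrite mem_iota add0n. Qed.

Lemma full_word_of c : full_word (word_of c).
Proof.
rewrite /full_word /unzip1 -map_comp; apply: uniq_perm; rewrite ?iota_uniq //.
  by rewrite map_inj_uniq ?enum_uniq // => i k /val_inj/perm_inj.
move=> v; rewrite mem_iota add0n; apply/mapP/idP => [[i _ ->] /=|vn].
  exact: ltn_ord.
by exists ((c.1)^-1%g (Ordinal vn)); rewrite ?mem_enum //= permKV.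
Qed.

Lemma word_of_surj u : full_word u -> exists c, word_of c = u.
Proof.
move=> fu; have size_u := size_full_word fu.
have lab_lt i : label u i < n.
  by rewrite -(mem_full_word _ fu); apply/mem_labelP; exists i; rewrite ?size_u.
have lab_inj : injective (fun i => Ordinal (lab_lt i)).
  move=> i k [/(label_inj (uniq_full_word fu))]; rewrite size_u => eq_ik.
  by apply/val_inj/eq_ik.
exists (perm lab_inj, [ffun i : 'I_n => sign u i]).
apply: (@eq_from_nth _ letter0) => [|i]; rewrite size_word_of // => i_lt.
rewrite (nth_word_of _ (Ordinal i_lt)) /step_letter /= permE ffunE /=.
by rewrite -surjective_pairing.
Qed.

Definition word_graph u : graph n :=
  [set [set ab.1; ab.2] | ab : 'I_n * 'I_n & word_adj u ab.1 ab.2].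

Lemma mem_word_graph u (a b : 'I_n) :
  ([set a; b] \in word_graph u) = word_adj u a b.
Proof.
apply/imsetP/idP => [[[c d]]|adj]; last by exists (a, b); rewrite ?inE.
by rewrite inE /= => adj /eq_set2[[-> ->]|[-> ->]]; rewrite // word_adj_sym.
Qed.

Lemma graph_of_word c : graph_of c = word_graph (word_of c).
Proof.
apply/setP => e; apply/imsetP/imsetP => -[[i k]]; rewrite inE /=.
  move=> /andP[ik sk] ->; exists (c.1 i, c.1 k) => //; rewrite inE /=.
  apply/word_adjP; exists i, k.
  rewrite size_word_of sign_word_of !label_word_of.
  by split => //; left.
move=> /word_adjP[j [l [jl ln sl ab]]] ->.
rewrite size_word_of in ln; have jn := ltn_trans jl ln.
move: sl ab; rewrite (sign_word_of c (Ordinal ln)).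
rewrite (label_word_of c (Ordinal jn)) (label_word_of c (Ordinal ln)) => sl ab.
exists (Ordinal jn, Ordinal ln); first by rewrite inE /= jl.
by case: ab => -[/val_inj -> /val_inj ->]; rewrite //= setUC.
Qed.

Lemma eq_word_graph u w :
  word_adj u =2 word_adj w -> word_graph u = word_graph w.
Proof.
move=> adj; apply/setP => e; apply/imsetP/imsetP => -[ab abu ->];
  by exists ab => //; move: abu; rewrite !inE adj.
Qed.

Lemma word_graph_inj u w : full_word u -> full_word w ->
  word_graph u = word_graph w -> word_adj u =2 word_adj w.
Proof.
move=> fu fw eq_graph a b.
have [ab|] := boolP ((a < n) && (b < n)).
  case/andP: ab => an bn.
  rewrite -(mem_word_graph u (Ordinal an) (Ordinal bn)) eq_graph.
  exact: mem_word_graph.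
have out (v : seq letter) :
    full_word v -> ~~ ((a < n) && (b < n)) -> word_adj v a b = false.
  move=> fv; rewrite -!(mem_full_word _ fv).
  by apply: contraNF => /word_adj_mem.
by move=> nab; rewrite !out.
Qed.

Lemma standard_formE c : 1 < n -> standard_form c = standard (word_of c).
Proof.
move=> n1; pose i0 := Ordinal (ltnW n1); pose i1 := Ordinal n1.
rewrite /standard uniq_full_word ?full_word_of //= andbC; congr (_ && _).
  rewrite /same_first_signs (sign_word_of c i0) (sign_word_of c i1).
  apply/forallP/eqP => [/(_ i0)/forallP/(_ i1)/eqP -> //|eq01 i].
  apply/forallP => k; apply/implyP => /andP[/eqP i_eq0 /eqP k_eq1].
  by rewrite (_ : i = i0) 1?(_ : k = i1) ?eq01 //; exact: val_inj.
apply/forallP/(sortedP letter0) => [increasing i|sorted_c i].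
  rewrite size_word_of => i1n; pose k := Ordinal i1n.
  pose j := Ordinal (ltnW i1n).
  rewrite (nth_word_of c j) (nth_word_of c k) /may_follow /= -implyNb negbK.
  have /forallP/(_ k) := increasing j; rewrite eqxx /= eq_sym => /implyP lt.
  by apply/implyP => /lt/ltnW.
apply/forallP => k; apply/implyP => /andP[/eqP ki /eqP eq_sign].
have := sorted_c i.
rewrite size_word_of -ki !nth_word_of /may_follow /= eq_sign eqxx.
move=> /(_ (ltn_ord k)) /= le; rewrite ltn_neqAle le andbT.
by apply/eqP => /val_inj/perm_inj ik; move: ki; rewrite ik; lia.
Qed.

End WordOfConstruction.

Section OddAnchors.

Section Word.
Variable u : seq letter.
Implicit Types i k m : nat.

Definition is_anchor i := all (fun y => label u i < y.1) (drop i.+1 u).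

(* The default [false] makes the first anchor odd iff its sign is +. *)
Fixpoint last_anchor_sign m : bool :=
  if m is k.+1 then if is_anchor k then sign u k else last_anchor_sign k
  else false.

Lemma last_anchor_sign_first m :
  (forall k, k < m -> ~~ is_anchor k) -> last_anchor_sign m = false.
Proof.
elim: m => //= m IH no_anchor; rewrite (negbTE (no_anchor m _)) //.
by apply: IH => k km; apply: no_anchor; exact: ltnW.
Qed.

Lemma last_anchor_sign_previous i m : is_anchor i -> i < m ->
  (forall k, i < k < m -> ~~ is_anchor k) -> last_anchor_sign m = sign u i.
Proof.
move=> ai; elim: m => //= m IH im no_anchor.
move: im; rewrite ltnS leq_eqVlt => /predU1P[<-|im]; first by rewrite ai.
rewrite (negbTE (no_anchor m _)) ?im ?leqnn //; apply: IH => // k /andP[ik km].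
by apply: no_anchor; rewrite ik ltnW.
Qed.

Lemma sign_changes_drop m : m <= size u ->
  sign_changes (last_anchor_sign m) (drop m u) =
  \sum_(m <= i < size u) (is_anchor i && (last_anchor_sign i != sign u i)).
Proof.
move=> /subKn <-; elim: (size u - m) (leq_subr m (size u)) => [|d IH] d_lt.
  by rewrite subn0 drop_size big_geq.
move: IH; rewrite -(subnSK d_lt); set k := size u - d.+1 => IH.
have k_lt : k < size u by rewrite /k; lia.
rewrite big_ltn // (drop_nth letter0 k_lt) -IH ?(ltnW d_lt) //= -/(is_anchor k).
by case: ifP.
Qed.

End Word.

Variables (n : nat) (c : signed_perm n).
Implicit Types i k p : 'I_n.

Lemma anchorE i : anchor c i = is_anchor (word_of c) i.
Proof.
apply/forallP/(all_nthP letter0) => [later k|later k].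
  rewrite size_drop size_word_of nth_drop => k_lt.
  have ik_lt : i.+1 + k < n by lia.
  rewrite (nth_word_of c (Ordinal ik_lt)) label_word_of.
  have /implyP := later (Ordinal ik_lt); apply.
  by rewrite /= addSn ltnS leq_addr.
apply/implyP => ik; have := later (k - i.+1).
rewrite size_drop size_word_of nth_drop subnKC // nth_word_of label_word_of.
by apply; rewrite ltn_sub2r // (leq_ltn_trans ik).
Qed.

Lemma exists_previous_anchor i k : anchor c k -> k < i ->
  exists p, previous_anchor c p i.
Proof.
move=> ak ki; have := @arg_maxnP _ k (fun p => anchor c p && (p < i)) val.
rewrite ak ki => /(_ isT)[p /andP[ap pi] p_max].
exists p; rewrite /previous_anchor ap pi.
apply/forallP => q; apply/implyP => /andP[pq qi]; apply/negP => aq.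
by have := p_max q; rewrite aq qi => /(_ isT); rewrite /= leqNgt pq.
Qed.

Lemma last_anchor_sign_previous_anchor p i :
  previous_anchor c p i -> last_anchor_sign (word_of c) i = c.2 p.
Proof.
move=> /and3P[ap pi /forallP between]; rewrite -sign_word_of.
apply: last_anchor_sign_previous; rewrite -?anchorE // => k /andP[pk ki].
have kn := ltn_trans ki (ltn_ord i).
by have /implyP := between (Ordinal kn); rewrite anchorE; apply; rewrite /= pk.
Qed.

Lemma label0_first_anchor i k : c.1 i = 0 :> nat -> anchor c k -> i <= k.
Proof.
move=> ci /forallP/(_ i)/implyP ak; rewrite leqNgt; apply/negP => /ak.
by rewrite ci.
Qed.

Lemma label0_anchor i : c.1 i = 0 :> nat -> anchor c i.
Proof.
move=> ci; apply/forallP => k; apply/implyP => ik; rewrite ci lt0n -ci.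
by apply: contraTneq ik => /val_inj/perm_inj ->; rewrite ltnn.
Qed.

Lemma odd_anchorE i : odd_anchor c i =
  anchor c i && (last_anchor_sign (word_of c) i != c.2 i).
Proof.
rewrite /odd_anchor; case: (boolP (anchor c i)) => //= ai.
have [ci|ci] := eqVneq (c.1 i : nat) 0.
  rewrite last_anchor_sign_first => [/=|k ki]; last first.
    have kn := ltn_trans ki (ltn_ord i); rewrite -(anchorE (Ordinal kn)).
    by apply: contraL ki => /(label0_first_anchor ci); rewrite -leqNgt.
  case: (c.2 i) => //=; apply/negbTE/existsPn => p.
  apply/negP => /andP[/and3P[/(label0_first_anchor ci) ip pi _] _].
  by rewrite ltnNge ip in pi.
have n0 : 0 < n := leq_ltn_trans (leq0n _) (ltn_ord i).
pose j := (c.1^-1)%g (Ordinal n0); have cj : c.1 j = 0 :> nat by rewrite permKV.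
have ji : j < i.
  rewrite ltn_neqAle (label0_first_anchor cj ai) andbT.
  by apply: contraNneq ci => /val_inj <-; rewrite cj.
have [q prev_q] := exists_previous_anchor (label0_anchor cj) ji.
apply/existsP/idP => [[p /andP[/last_anchor_sign_previous_anchor <- //]]|neq].
by exists q; rewrite prev_q -(last_anchor_sign_previous_anchor prev_q).
Qed.

Lemma card_odd_anchor :
  #|[set i | odd_anchor c i]| = sign_changes false (word_of c).
Proof.
have := sign_changes_drop (leq0n (size (word_of c))).
rewrite drop0 => ->; rewrite size_word_of big_mkord -sum1dep_card big_mkcond /=.
apply: eq_bigr => i _; rewrite odd_anchorE anchorE sign_word_of.
by case: (_ && _).
Qed.

End OddAnchors.

Section StandardWords.
Variable n : nat.
Hypothesis n1 : 1 < n.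
Implicit Types (c : signed_perm n) (u w : seq letter).

Let i0 : 'I_n := Ordinal (ltnW n1).

Definition full_standard u := full_word n u && standard u.

Lemma full_word_standardize u : full_word n u -> full_word n (standardize u).
Proof. exact: perm_trans (perm_standardize u). Qed.

Lemma full_standard_standardize u :
  full_word n u -> full_standard (standardize u).
Proof.
move=> fu; rewrite /full_standard full_word_standardize // /standard.
rewrite (uniq_full_word (full_word_standardize fu)) sorted_word_sort.
by rewrite same_first_signs_standardize // (size_full_word fu).
Qed.

Lemma full_standard_graph_inj u w : full_standard u -> full_standard w ->
  word_graph n u = word_graph n w -> u = w.
Proof.
move=> /andP[fu su] /andP[fw sw] eq_graph; apply: standard_word_inj => //.
- by rewrite (size_full_word fu).
- by rewrite (permPl fu) perm_sym.
- exact: word_graph_inj eq_graph.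
Qed.

Lemma word_graph_standardize u : word_graph n (standardize u) = word_graph n u.
Proof. by apply: eq_word_graph; exact: word_adj_standardize. Qed.

Lemma standardize_unique u w : full_word n u -> full_standard w ->
  word_graph n w = word_graph n u -> standardize u = w.
Proof.
move=> fu sw eq_graph; apply: full_standard_graph_inj => //.
  exact: full_standard_standardize.
by rewrite word_graph_standardize.
Qed.

Lemma in_first_blockE c (v : 'I_n) : v = 0 :> nat ->
  in_first_block (graph_of c) v = (label (standardize (word_of c)) 0 == 0).
Proof.
move=> v0; have fc := full_word_of c.
apply/existsP/idP => [[d /and3P[sd /eqP gd]]|].
  move=> /existsP[i /andP[/eqP di /forallP same]].
  have -> : standardize (word_of c) = word_of d.
    apply: standardize_unique; rewrite // -?graph_of_word //.
    by rewrite /full_standard full_word_of -standard_formE.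
  rewrite (label_word_of d i0); suff -> : i0 = i by rewrite di v0.
  apply: val_inj => /=; case i_pred : (val i) => [//|k].
  have i_eq : nat_of_ord i = k.+1 := i_pred.
  have kn : k < n by have := ltn_ord i; lia.
  have := same (Ordinal kn); rewrite /= i_eq leqnSn /= => same_sign.
  have /andP[_ /forallP/(_ (Ordinal kn))/forallP/(_ i)] := sd.
  by rewrite /= i_eq eqxx same_sign /= di v0.
have /andP[fs ss] := full_standard_standardize fc.
have [d dE] := word_of_surj fs.
rewrite -dE (label_word_of d i0) => /eqP d0; exists d.
rewrite standard_formE // dE ss.
rewrite !graph_of_word dE word_graph_standardize eqxx /=.
apply/existsP; exists i0; rewrite -val_eqE /= d0 v0 eqxx /=.
apply/forallP => k; apply/implyP; rewrite leqn0 => /eqP k0.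
by rewrite (_ : k = i0) //; exact: val_inj.
Qed.

Lemma follows_conventionE c : follows_convention c =
  (label (standardize (word_of c)) 0 == 0) ==>
  (label (word_of c) 0 == 0) && sign (word_of c) 0.
Proof.
rewrite (label_word_of c i0) (sign_word_of c i0).
apply/forallP/implyP => [conv lab0|conv v].
  have /implyP := conv i0; rewrite in_first_blockE // lab0 => /(_ isT).
  move=> /existsP[i /and3P[/eqP i_eq0 /eqP ci si]].
  have <- : i = i0 by exact: val_inj.
  by rewrite ci si.
apply/implyP => /andP[/eqP v0].
rewrite in_first_blockE // => /conv/andP[/eqP ci si].
by apply/existsP; exists i0; rewrite si -val_eqE /= ci v0.
Qed.

Lemma standardize_label0 x u : x.1 = 0 ->
  exists s, standardize (x :: u) = (x.1, s) :: word_sort u.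
Proof.
move=> x0; case: u => [|y u].
  by exists x.2; rewrite /standardize /= -surjective_pairing.
by exists y.2; rewrite /standardize /= insert_label0.
Qed.

Lemma sign_changes_convention c : follows_convention c ->
  sign_changes false (word_of c) = odd_stat (standardize (word_of c)).
Proof.
rewrite follows_conventionE; have := full_word_of c.
case: (word_of c) => [/size_full_word /= n0|x u fu].
  by have := n1; rewrite -n0.
have /= /andP[xu _] := uniq_full_word fu.
rewrite /odd_stat -[label (x :: u) 0]/x.1 -[sign (x :: u) 0]/x.2.
have [x0|x0] := eqVneq x.1 0.
  have [s ->] := standardize_label0 u x0; rewrite /label /= x0 eqxx /= => x_pos.
  rewrite x_pos sign_changes_sort -x0 ifT //.
  apply/allP => y yu; rewrite x0 lt0n; apply: contraNneq xu => y0.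
  by rewrite x0 -y0 (map_f fst yu).
rewrite implybF => /negbTE ->; rewrite sign_changes_sort.
have not_anchor : all (fun y => x.1 < y.1) u = false.
  apply/negP => /allP x_lt; have := mem_full_word 0 fu; rewrite (ltnW n1) inE.
  rewrite eq_sym (negbTE x0) => /mapP[y yu y0].
  by have := x_lt y yu; rewrite -y0.
by rewrite /= not_anchor; case: u not_anchor {fu xu} => [|y u] //= ->.
Qed.

Lemma convention_exists c :
  exists2 d : signed_perm n, graph_of d = graph_of c & follows_convention d.
Proof.
have /andP[fs ss] := full_standard_standardize (full_word_of c).
have [lab0|lab0] := boolP (label (standardize (word_of c)) 0 == 0); last first.
  have [d dE] := word_of_surj fs; exists d.
    by rewrite !graph_of_word dE word_graph_standardize.
  rewrite follows_conventionE dE.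
  rewrite (standardize_unique fs (w := standardize (word_of c))) //.
    by rewrite (negbTE lab0).
  by rewrite /full_standard fs.
case E : (standardize (word_of c)) lab0 => [|x u] lab0.
  by have := size_full_word fs; have := n1; rewrite E /=; lia.
have [d dE] : exists d : signed_perm n, word_of d = (x.1, true) :: u.
  by apply: word_of_surj; rewrite E in fs.
exists d; last by rewrite follows_conventionE dE; apply/implyP => _; apply/andP.
rewrite !graph_of_word dE -(word_graph_standardize (word_of c)) E.
exact: eq_word_graph.
Qed.

Lemma odd_anchors_graph_of c :
  odd_anchors (graph_of c) = odd_stat (standardize (word_of c)).
Proof.
rewrite /odd_anchors; case: pickP => [d /andP[/eqP gd conv]|none]; last first.
  have [d gd conv] := convention_exists c.
  by have := none d; rewrite gd eqxx conv.
rewrite card_odd_anchor sign_changes_convention //; congr odd_stat.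
apply: standardize_unique; rewrite ?full_standard_standardize ?full_word_of //.
by rewrite word_graph_standardize -!graph_of_word.
Qed.

Definition standard_words :=
  [seq u <- canonical_words n (iota 0 n) letter0 | same_first_signs u].

Lemma mem_standard_words u : (u \in standard_words) = full_standard u.
Proof.
rewrite mem_filter mem_canonical_words ?size_iota // -sorted_may_follow.
rewrite /full_standard /standard andbC -andbA.
by apply: andb_id2l => /(@uniq_full_word n) ->.
Qed.

Lemma card_threshold_odd_anchors j :
  #|[set G : graph n | is_threshold G && (odd_anchors G == j)]|
  = count (fun u => odd_stat u == j) standard_words.
Proof.
pose L := [seq u <- standard_words | odd_stat u == j].
have memL u : (u \in L) = (odd_stat u == j) && full_standard u.
  by rewrite mem_filter mem_standard_words.
have uniq_graphs : uniq (map (word_graph n) L).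
  rewrite map_inj_in_uniq ?filter_uniq ?uniq_canonical_words ?iota_uniq //.
  move=> u w; rewrite !memL => /andP[_ su] /andP[_ sw].
  exact: full_standard_graph_inj.
rewrite -size_filter -(size_map (word_graph n)) -(card_uniqP uniq_graphs).
apply: eq_card => G; rewrite inE.
apply/andP/mapP => [[/existsP[c /eqP <-] oj]|[u]].
  exists (standardize (word_of c)).
    rewrite memL -odd_anchors_graph_of oj.
    exact: full_standard_standardize (full_word_of c).
  by rewrite word_graph_standardize graph_of_word.
rewrite memL => /andP[oj su ->]; have [c cE] := word_of_surj (proj1 (andP su)).
rewrite -cE -graph_of_word odd_anchors_graph_of.
split; first by apply/existsP; exists c.
by rewrite (standardize_unique (full_word_of c) su) ?cE.
Qed.

End StandardWords.

Section Comparison.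
Local Open Scope ring_scope.

Lemma poly_eq_infinite (R : idomainType) (x : nat -> R) (p q : {poly R}) :
  injective x -> (forall m, p.[x m] = q.[x m]) -> p = q.
Proof.
move=> inj_x pq; apply/eqP; rewrite -subr_eq0; apply/eqP.
apply: (@roots_geq_poly_eq0 _ _ [seq x m | m <- iota 0 (size (p - q))]).
- by apply/allP => _ /mapP[m _ ->]; rewrite rootE hornerD hornerN pq subrr.
- by rewrite map_inj_uniq ?iota_uniq.
- by rewrite size_map size_iota.
Qed.

Definition signed_odd_poly n : {poly int} :=
  \sum_(u <- standard_words n) (-1) ^+ (n + odd_stat u) *: 'X^(odd_stat u).

Lemma coef_signed_odd_poly n j : (signed_odd_poly n)`_j =
  (-1) ^+ (n + j) * (count (fun u => odd_stat u == j) (standard_words n))%:Z.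
Proof.
rewrite /signed_odd_poly coef_sum -sum1_count.
rewrite (big_morph Posz PoszD erefl) big_distrr [RHS]big_mkcond /=.
apply: eq_bigr => u _; rewrite coefZ coefXn eq_sym.
by case: eqP => [->|_]; rewrite ?mulr0.
Qed.

Lemma horner_signed_odd_poly n m : (1 < n)%N ->
  (signed_odd_poly n).[(2 * m).+1%:Z]
  = (colorings n 0 m 0 + n * colorings n.-1 0 m 0)%N%:Z.
Proof.
case: n => [|[|n]] // _; rewrite /signed_odd_poly horner_sum.
pose t := - (2 * m).+1%:Z.
transitivity ((-1) ^+ n.+2 * \sum_(u <- standard_words n.+2) t ^+ odd_stat u).
  rewrite big_distrr; apply: eq_bigr => u _.
  by rewrite hornerZ hornerXn /t exprD -mulrA -exprMn mulN1r.
rewrite big_filter sum_odd_stat ?size_iota ?iota_uniq // PoszD PoszM.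
rewrite -!word_sum_reciprocity -/t [n.+2.-1]/= exprS natz; ring.
Qed.

Lemma arr_char_poly_threshold_words (R : realType) n : (1 < n)%N ->
  arr_char_poly (threshold_arrangement R n) = signed_odd_poly n.
Proof.
move=> n1; apply: (@poly_eq_infinite _ (fun m => (2 * m).+1%:Z)) => [k l []|m].
  by lia.
by rewrite arr_char_poly_threshold horner_signed_odd_poly.
Qed.

End Comparison.

Theorem theorem5p11 (R : realType) (n j : nat) (hn : (2 <= n)%N) (hj : (j <= n)%N) :
  `|((arr_char_poly (threshold_arrangement R n))`_j)%R|%N
  = #|[set G : graph n | is_threshold G && (odd_anchors G == j)]|.
Proof.
rewrite arr_char_poly_threshold_words // coef_signed_odd_poly.
by rewrite abszM abszX exp1n mul1n card_threshold_odd_anchors.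
Qed.
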